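(* Let $\Omega\subset\mathbb R^n$ be a bounded domain and let $X_1,\dots,X_m\in C^2(\Omega,\mathbb R^n)$ be vector fields satisfying Hörmander's condition, with associated Carnot-Carathéodory metric $d_{cc}$. Suppose $u\in W^{1,\infty}_{cc}(\Omega)$ is an absolutely minimizing Lipschitz extension (AMLE) with respect to $d_{cc}$. Then $u$ is a viscosity solution to the subelliptic $\infty$-Laplacian equation $$-\sum_{i,j=1}^m X_iu\,X_ju\,X_iX_ju=0\quad\text{in }\Omega.$$
   Context: Hörmander's condition: there is an integer $r\ge1$ such that at every $x\in\Omega$ the vectors $X_1,\dots,X_m$ and all their iterated commutators of order at most $r$ (assumed to be defined) span $\mathbb R^n$. $d_{cc}(p,q)$ is the infimum of all $\delta>0$ for which there is a curve $\gamma:[0,\delta]\to\Omega$ with $\gamma(0)=p$, $\gamma(\delta)=q$, $\gamma'(t)=\sum_{i=1}^m a_i(t)X_i(\gamma(t))$, $\sum_i a_i(t)^2\le1$. $Xu=(X_1u,\dots,X_mu)$ is the (distributional) horizontal gradient. $W^{1,\infty}_{cc}(\Omega)=\{u:\Omega\to\mathbb R:\ \|u\|_{L^\infty(\Omega)}+\|Xu\|_{L^\infty(\Omega)}<\infty\}$; elements are identified with their continuous representatives. AMLE with respect to $d_{cc}$: for open $U\subset\Omega$ and $v\in W^{1,\infty}_{cc}(U)$ put $F(v,U)=\sup_{x\in U}\sum_{i=1}^m (X_iv(x))^2$ (essential supremum). $u\in W^{1,\infty}_{cc}(\Omega)$ is an AMLE if for every open $\tilde\Omega\subset\Omega$ and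 every $w\in W^{1,\infty}_{cc}(\tilde\Omega)$ with $w=u$ on $\partial\tilde\Omega$ one has $F(u,\tilde\Omega)\le F(w,\tilde\Omega)$. Viscosity solution: with $(D^2\phi)^*_{ij}=\frac12(X_iX_j+X_jX_i)\phi$ and $A[\phi]=-\sum_{i,j}X_i\phi X_j\phi (D^2\phi)^*_{ij}=-\sum_{i,j}X_i\phi X_j\phi X_iX_j\phi$, $u\in C(\Omega)$ is a viscosity subsolution if $A[\phi](x_0)\le0$ whenever $\phi\in C^2(\Omega)$ and $u-\phi$ has a local maximum at $x_0\in\Omega$; a viscosity supersolution if $A[\phi](x_0)\ge0$ whenever $\phi\in C^2(\Omega)$ and $u-\phi$ has a local minimum at $x_0\in\Omega$; a viscosity solution if both. *)

(* Defs.v *)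
From HB Require Import structures.
From mathcomp Require Import all_boot all_order all_algebra.
From mathcomp Require Import all_classical all_reals all_analysis.
From mathcomp Require Import ess_sup_inf ring.

Set Implicit Arguments.
Unset Strict Implicit.
Unset Printing Implicit Defensive.

Import Order.TTheory GRing.Theory Num.Theory.
Import numFieldNormedType.Exports.

Local Open Scope classical_set_scope.
Local Open Scope ring_scope.

(** R^n is ['rV[R]_n], with the sigma-algebra generated by the coordinates
    (i.e. the Borel sigma-algebra), as for [n.-tuple R] in the library. *)
Section measurable_row.
Context {R : realType} (n : nat).

Let coor (i : 'I_n) (x : 'rV[R]_n) : measurableTypeR R := x ord0 i.

Let row_set0 : g_sigma_preimage coor set0.
Proof. exact: sigma_algebra0. Qed.

Let row_setC A : g_sigma_preimage coor A -> g_sigma_preimage coor (~` A).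
Proof. exact: sigma_algebraC. Qed.

Let row_bigcup (F : (set 'rV[R]_n)^nat) :
  (forall i, g_sigma_preimage coor (F i)) ->
  g_sigma_preimage coor (\bigcup_i (F i)).
Proof. exact: sigma_algebra_bigcup. Qed.

HB.instance Definition _ :=
  @isMeasurable.Build (measure_tuple_display default_measure_display)
    'rV[R]_n (g_sigma_preimage coor) row_set0 row_setC row_bigcup.

Lemma measurable_coor (i : 'I_n) :
  measurable_fun [set: 'rV[R]_n] (fun x : 'rV[R]_n => x ord0 i : measurableTypeR R).
Proof.
move=> _ Y mY; rewrite setTI; apply: sub_sigma_algebra => /=.
rewrite -bigcup_seq/=; exists i => /=; first by rewrite mem_index_enum.
by exists Y => //; rewrite setTI.
Qed.

Lemma measurable_fun_rowP d (T : measurableType d) (f : T -> 'rV[R]_n) :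
  (forall i, measurable_fun [set: T] (fun t => f t ord0 i : measurableTypeR R)) ->
  measurable_fun [set: T] f.
Proof.
move=> mf _ A mA; rewrite setTI.
pose S := [set B : set 'rV[R]_n | measurable (f @^-1` B)].
suff : measurable `<=` S by exact.
apply: smallest_sub.
  split.
  - by rewrite /S/= preimage_set0; exact: measurable0.
  - by move=> B; rewrite /S/= setTD preimage_setC; exact: measurableC.
  - by move=> F SF; rewrite /S/= preimage_bigcup; exact: bigcupT_measurable.
move=> B; rewrite -bigcup_seq => -[i _ [C mC <-]].
by rewrite /S/= setTI -comp_preimage -[X in measurable X]setTI; exact: mf.
Qed.

End measurable_row.

Section lebesgue_row.
Context {R : realType}.

Definition row_cons n (p : measurableTypeR R * 'rV[R]_n) : 'rV[R]_n.+1 :=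
  \row_i oapp (p.2 ord0) p.1 (unlift ord0 i).

Definition row_uncons n (x : 'rV[R]_n.+1) : measurableTypeR R * 'rV[R]_n :=
  (x ord0 ord0, \row_j x ord0 (lift ord0 j)).

Lemma row_consE0 n p : @row_cons n p ord0 ord0 = p.1.
Proof. by rewrite mxE unlift_none. Qed.

Lemma row_consES n p i : @row_cons n p ord0 (lift ord0 i) = p.2 ord0 i.
Proof. by rewrite mxE liftK. Qed.

Lemma row_consK n : cancel (@row_cons n) (@row_uncons n).
Proof.
move=> [t x]; rewrite /row_uncons row_consE0; congr pair.
by apply/rowP => j; rewrite mxE row_consES.
Qed.

Lemma row_unconsK n : cancel (@row_uncons n) (@row_cons n).
Proof.
move=> x; apply/rowP => i; case: (unliftP ord0 i) => [j|] ->.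
  by rewrite row_consES mxE.
by rewrite row_consE0.
Qed.

Lemma measurable_row_cons n : measurable_fun setT (@row_cons n).
Proof.
apply: measurable_fun_rowP => i; case: (unliftP ord0 i) => [j|] ->.
  rewrite (_ : (fun _ => _) = (fun x : 'rV[R]_n => x ord0 j) \o snd); last first.
    by apply/funext => p/=; rewrite row_consES.
  by apply: measurableT_comp; [exact: measurable_coor|exact: measurable_snd].
rewrite (_ : (fun _ => _) = fst); first exact: measurable_fst.
by apply/funext => p/=; rewrite row_consE0.
Qed.

Lemma measurable_row_uncons n : measurable_fun setT (@row_uncons n).
Proof.
apply/measurable_fun_pairP; split; first exact: measurable_coor.
apply: measurable_fun_rowP => i.
rewrite (_ : (fun _ => _) = fun x : 'rV[R]_n.+1 => x ord0 (lift ord0 i)).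
  exact: measurable_coor.
by apply/funext => x /=; rewrite mxE.
Qed.

Section step.
Variables (n : nat) (mu : {sigma_finite_measure set 'rV[R]_n -> \bar R}).

Definition lebesgue_cons : set 'rV[R]_n.+1 -> \bar R :=
  pushforward (lebesgue_measure \x mu)%E (@row_cons n).

Let lebesgue_cons0 : lebesgue_cons set0 = 0%E.
Proof. by rewrite /lebesgue_cons /pushforward preimage_set0 measure0. Qed.

Let lebesgue_cons_ge0 A : (0 <= lebesgue_cons A)%E.
Proof. by rewrite /lebesgue_cons /pushforward; exact: measure_ge0. Qed.

Let lebesgue_cons_sigma_additive : semi_sigma_additive lebesgue_cons.
Proof.
move=> F mF tF mUF; rewrite /lebesgue_cons /pushforward preimage_bigcup.
apply: measure_semi_sigma_additive.
- by move=> k; rewrite -[X in measurable X]setTI; exact: measurable_row_cons.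
- apply/trivIsetP => /= i j _ _ ij; rewrite -preimage_setI.
  by move/trivIsetP : tF => /(_ _ _ _ _ ij) ->//; rewrite preimage_set0.
- rewrite -preimage_bigcup -[X in measurable X]setTI.
  exact: measurable_row_cons.
Qed.

HB.instance Definition _ := isMeasure.Build _ _ _ lebesgue_cons
  lebesgue_cons0 lebesgue_cons_ge0 lebesgue_cons_sigma_additive.

Let lebesgue_cons_sigma_finite : sigma_finite setT lebesgue_cons.
Proof.
have /sigma_finiteP[F [TF ndF Foo]] :=
  sigma_finiteT (@lebesgue_measure R : {sigma_finite_measure set _ -> \bar R}).
have /sigma_finiteP[G [TG ndG Goo]] := sigma_finiteT mu.
exists (fun k => @row_uncons n @^-1` (F k `*` G k)).
  rewrite -preimage_bigcup (_ : \bigcup_k _ = setT) ?preimage_setT//.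
  apply/seteqP; split => // -[x y] _.
  have [j _ Fjx] : (\bigcup_i F i) x by rewrite -TF.
  have [k _ Gky] : (\bigcup_i G i) y by rewrite -TG.
  exists (maxn j k) => //; split => /=.
  - by move: x Fjx; exact/subsetPset/ndF/leq_maxl.
  - by move: y Gky; exact/subsetPset/ndG/leq_maxr.
move=> k; have [mF Fk] := Foo k; have [mG Gk] := Goo k; split.
  rewrite -[X in measurable X]setTI; apply: measurable_row_uncons => //.
  exact: measurableX.
rewrite /lebesgue_cons /pushforward -comp_preimage.
rewrite (_ : _ \o _ = id); last by apply/funext => p /=; rewrite row_consK.
rewrite preimage_id product_measure1E//.
by rewrite lte_mul_pinfty// ge0_fin_numE.
Qed.

HB.instance Definition _ := Measure_isSigmaFinite.Build _ _ _ lebesgue_cons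
  lebesgue_cons_sigma_finite.

End step.

Fixpoint lebesgue_rV n : {sigma_finite_measure set 'rV[R]_n -> \bar R} :=
  match n with
  | 0 => [the {sigma_finite_measure set 'rV[R]_0 -> \bar R} of
           \d_(0 : 'rV[R]_0)]
  | k.+1 => [the {sigma_finite_measure set 'rV[R]_k.+1 -> \bar R} of
              lebesgue_cons (lebesgue_rV k)]
  end.

Lemma measurable_rV_box n (A : 'I_n -> set (measurableTypeR R)) :
  (forall i, measurable (A i)) ->
  measurable [set x : 'rV[R]_n | forall i, A i (x ord0 i)].
Proof.
move=> mA; rewrite (_ : mkset _ =
    \big[setI/setT]_(i < n) ((fun x : 'rV[R]_n => x ord0 i) @^-1` A i)).
  apply: bigsetI_measurable => i _; rewrite -[X in measurable X]setTI.
  exact: measurable_coor.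
apply/seteqP; split => x /=.
  by move=> Ax; rewrite -bigcap_seq => i _ /=; exact: Ax.
rewrite -bigcap_seq => Ax i; have := Ax i (mem_index_enum i); exact.
Qed.

Lemma lebesgue_rV_box n (A : 'I_n -> set (measurableTypeR R)) :
  (forall i, measurable (A i)) ->
  lebesgue_rV n [set x | forall i, A i (x ord0 i)] =
  (\prod_(i < n) lebesgue_measure (A i))%E.
Proof.
elim: n A => [|n IHn] A mA.
  by rewrite big_ord0 /= diracE mem_set// => -[].
rewrite big_ord_recl /= /lebesgue_cons /pushforward.
rewrite (_ : _ @^-1` _ = A ord0 `*`
    [set x : 'rV[R]_n | forall i, A (lift ord0 i) (x ord0 i)]).
  rewrite product_measure1E//; last exact: (@measurable_rV_box n (fun i => A (lift ord0 i))).
  by congr (_ * _)%E; exact: (IHn (fun i => A (lift ord0 i))).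
apply/seteqP; split => -[t x] /=.
  by move=> Ax; split => [|i]; [have := Ax ord0|have := Ax (lift ord0 i)];
    rewrite ?row_consE0 ?row_consES.
move=> [At Ax] i; case: (unliftP ord0 i) => [j|] ->.
  by rewrite row_consES; exact: Ax.
by rewrite row_consE0.
Qed.

End lebesgue_row.
Arguments lebesgue_rV {R} n.

(** U is meant to be open.  Here and below functions are total, but only their
    values on the open set under consideration are used. *)
Fixpoint Ck {R : realType} {n : nat} {W : normedModType R} (k : nat)
    (U : set 'rV[R]_n) (f : 'rV[R]_n -> W) : Prop :=
  match k with
  | 0 => forall x, U x -> {for x, continuous f}
  | k'.+1 => (forall x, U x -> differentiable f x) /\
             (forall v : 'rV[R]_n, Ck k' U ('D_v f))
  end.

Section horizontal.
Context {R : realType} {n m : nat}.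
Implicit Types (U : set 'rV[R]_n) (f : 'rV[R]_n -> R).
Local Notation vfield := ('rV[R]_n -> 'rV[R]_n).
Implicit Types (Y Z : vfield) (X : 'I_m -> vfield).

Definition bounded_domain (U : set 'rV[R]_n) : Prop :=
  [/\ open U, connected U, U !=set0 & bounded_set U].

Definition boundary (U : set 'rV[R]_n) : set 'rV[R]_n := closure U `\` U°.

Definition vderiv Y f : 'rV[R]_n -> R := fun x => 'D_(Y x) f x.

Definition divergence Y : 'rV[R]_n -> R :=
  fun x => \sum_(j < n) 'D_(delta_mx ord0 j) (fun y => Y y ord0 j) x.

Definition lie_bracket Y Z : vfield :=
  fun x => 'D_(Y x) Z x - 'D_(Z x) Y x.

Inductive commutator : Type :=
  | Gen of 'I_m
  | Br of commutator & commutator.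

(** The number of generators: [X_i, X_j] has order 2. *)
Fixpoint commutator_order (c : commutator) : nat :=
  match c with
  | Gen _ => 1
  | Br c1 c2 => commutator_order c1 + commutator_order c2
  end.

Fixpoint commutator_field X (c : commutator) : vfield :=
  match c with
  | Gen i => X i
  | Br c1 c2 => lie_bracket (commutator_field X c1) (commutator_field X c2)
  end.

(** The fields are only C^2, so a commutator of commutators need not make sense;
    it does when both arguments of every bracket are differentiable on U. *)
Fixpoint commutator_defined X U (c : commutator) : Prop :=
  match c with
  | Gen _ => True
  | Br c1 c2 =>
      [/\ commutator_defined X U c1, commutator_defined X U c2 &
        forall x, U x -> differentiable (commutator_field X c1) x /\
                         differentiable (commutator_field X c2) x]
  end.

Definition hormander X U : Prop :=
  exists r : nat, [/\ (1 <= r)%N,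
    (forall c, (commutator_order c <= r)%N -> commutator_defined X U c) &
    forall x, U x -> exists k (c : 'I_k -> commutator),
      (forall i, (commutator_order (c i) <= r)%N) /\
      row_full (\matrix_(i < k) commutator_field X (c i) x)].

Definition test_function U (phi : 'rV[R]_n -> R) : Prop :=
  (forall k, Ck k setT phi) /\
  exists2 K : set 'rV[R]_n, compact K /\ K `<=` U &
    forall x, ~ K x -> phi x = 0.

Definition loc_integrable U (g : 'rV[R]_n -> R) : Prop :=
  forall K : set 'rV[R]_n, compact K -> K `<=` U ->
    (lebesgue_rV n).-integrable K (EFin \o g).

(** The formal adjoint of the derivation Y is phi |-> - div (phi Y). *)
Definition is_weak_vderiv Y U (v g : 'rV[R]_n -> R) : Prop :=
  [/\ loc_integrable U v, loc_integrable U g &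
    forall phi, test_function U phi ->
      \int[lebesgue_rV n]_(x in U) (g x * phi x) =
      - \int[lebesgue_rV n]_(x in U)
          (v x * divergence (fun y => phi y *: Y y) x)].

Definition is_hgrad X U (v : 'rV[R]_n -> R) (g : 'rV[R]_n -> 'rV[R]_m) : Prop :=
  forall i, is_weak_vderiv (X i) U v (fun x => g x ord0 i).

(** Xv on U, when it exists as a locally integrable function (it is then
    unique almost everywhere). *)
Definition hgrad X U (v : 'rV[R]_n -> R) : 'rV[R]_n -> 'rV[R]_m :=
  xget (fun=> 0) [set g | is_hgrad X U v g].

(** Only used for f >= 0: [f \_ U] is f on U and 0 elsewhere. *)
Definition ess_sup_on U (f : 'rV[R]_n -> R) : \bar R :=
  ess_sup (lebesgue_rV n) ((EFin \o f) \_ U).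

Definition Linfty_norm (W : normedModType R) U (f : 'rV[R]_n -> W) : \bar R :=
  ess_sup_on U (fun x => `|f x|).

(** Elements of W^{1,oo}_cc(U) are identified with their continuous
    representatives. *)
Definition W1oo_cc X U (v : 'rV[R]_n -> R) : Prop :=
  [/\ forall x, U x -> {for x, continuous v},
      exists g, is_hgrad X U v g &
      (Linfty_norm U v + Linfty_norm U (hgrad X U v) < +oo)%E].

Definition F_energy X (v : 'rV[R]_n -> R) U : \bar R :=
  ess_sup_on U (fun x => \sum_(i < m) hgrad X U v x ord0 i ^+ 2).

(** w is only defined on U and u need not extend continuously to the points
    of the boundary of U that lie outside of Omega, so w = u on the boundary of
    U means that w - u tends to 0 there; at a boundary point y in Omega this
    says that w x tends to u y. *)
Definition eq_on_boundary U (w u : 'rV[R]_n -> R) : Prop :=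
  forall y, boundary U y -> w x - u x @[x --> within U (nbhs y)] --> (0 : R).

Definition AMLE X (Omega : set 'rV[R]_n) (u : 'rV[R]_n -> R) : Prop :=
  W1oo_cc X Omega u /\
  forall U, open U -> U `<=` Omega ->
  forall w, W1oo_cc X U w -> eq_on_boundary U w u ->
    (F_energy X u U <= F_energy X w U)%E.

Definition sym_hessian X (phi : 'rV[R]_n -> R) (i j : 'I_m) : 'rV[R]_n -> R :=
  fun x => 2^-1 * (vderiv (X i) (vderiv (X j) phi) x +
                   vderiv (X j) (vderiv (X i) phi) x).

Definition inf_laplace_op X (phi : 'rV[R]_n -> R) : 'rV[R]_n -> R := fun x =>
  - \sum_(i < m) \sum_(j < m)
      vderiv (X i) phi x * vderiv (X j) phi x * sym_hessian X phi i j x.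

Lemma sum_symmetrize (p : 'I_m -> R) (h : 'I_m -> 'I_m -> R) :
  \sum_i \sum_j p i * p j * (2^-1 * (h i j + h j i)) =
  \sum_i \sum_j p i * p j * h i j.
Proof.
transitivity (\sum_i \sum_j 2^-1 * (p i * p j * h i j + p j * p i * h j i)).
  by do 2![apply: eq_bigr => ? _]; ring.
under eq_bigr do rewrite -mulr_sumr big_split/=.
rewrite -mulr_sumr big_split/= [X in _ + X]exchange_big/= -mulr2n.
by rewrite -[X in _ * X]mulr_natl mulrA mulVf ?mul1r// pnatr_eq0.
Qed.

Lemma inf_laplace_opE X phi x : inf_laplace_op X phi x =
  - \sum_(i < m) \sum_(j < m)
      vderiv (X i) phi x * vderiv (X j) phi x *
      vderiv (X i) (vderiv (X j) phi) x.
Proof.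
congr (- _).
exact: (sum_symmetrize (fun i => vderiv (X i) phi x)
  (fun i j => vderiv (X i) (vderiv (X j) phi) x)).
Qed.

Definition viscosity_subsolution X Omega (u : 'rV[R]_n -> R) : Prop :=
  forall (phi : 'rV[R]_n -> R) x0, Ck 2 Omega phi -> Omega x0 ->
    (\forall x \near x0, u x - phi x <= u x0 - phi x0) ->
    inf_laplace_op X phi x0 <= 0.

Definition viscosity_supersolution X Omega (u : 'rV[R]_n -> R) : Prop :=
  forall (phi : 'rV[R]_n -> R) x0, Ck 2 Omega phi -> Omega x0 ->
    (\forall x \near x0, u x0 - phi x0 <= u x - phi x) ->
    0 <= inf_laplace_op X phi x0.

Definition viscosity_solution X Omega (u : 'rV[R]_n -> R) : Prop :=
  [/\ forall x, Omega x -> {for x, continuous u},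
      viscosity_subsolution X Omega u & viscosity_supersolution X Omega u].

End horizontal.

(* Main.v *)
Require Import Defs.
From mathcomp Require Import all_boot all_order all_algebra.
From mathcomp Require Import all_classical all_reals all_analysis.
From mathcomp Require Import measurable_realfun ess_sup_inf ring lra.

(** Suppose [u - phi] has a local maximum at [x0] and [A[phi](x0) > 0]. Let
    [beta] be the differential at [x0] of [|X phi|^2 / 2] and [a = \sum_i X_i
    phi(x0) X_i(x0)], so that [beta(a) = - A[phi](x0) < 0]. There is then a
    positive definite quadratic form [q] in [x - x0] whose Hessian maps [a] to
    [- beta]; hence [psi = phi + q] touches [u] strictly from above and [|X
    psi|^2] is stationary at [x0]. Put [w = psi + (u - phi)(x0) - c r^2]: the
    set [U = {w < u}] lies in the ball of radius [r], and minimality gives [|X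
    u|^2 <= |X psi(x0)|^2 + o(r)] a.e. on [U]. Tilting [psi] by [- delta beta],
    with [delta] a small multiple of [r], raises [|X psi|^2] by an amount of
    order [r], while [u] minus the tilted function still has a maximum inside
    [U]. This contradicts the fact that an a.e. bound on the weak horizontal
    gradient holds in the viscosity sense, which follows by mollifying [u] with
    a Friedrichs-type commutator estimate. The distributional gradient of [w] is
    its classical one by the fundamental lemma of the calculus of variations,
    tested on products of the functions [exp(-1/t)]. Supersolutions follow by
    replacing [u] with [- u]. *)

Set Implicit Arguments.
Unset Strict Implicit.
Unset Printing Implicit Defensive.

Import Order.TTheory GRing.Theory Num.Def Num.Theory.
Import numFieldNormedType.Exports.

Local Open Scope classical_set_scope.
Local Open Scope ring_scope.

(** * Topology of row vectors *)

Section row_topology.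
Context {R : realType} {n : nat}.
Implicit Types (x y v : 'rV[R]_n) (U A : set 'rV[R]_n).

(** The correction [q] settles a contest of scales. On a ball of radius r the tilt can only have a
    slope of order r, otherwise the maximum of u minus the tilted function may leave U; so it gains
    only order r in the squared gradient. Without [q], |X phi|^2 itself varies by order r over the
    ball, with a constant that could swallow the gain; with [q] the variation is o(r). A positive
    definite Hessian H with H a = - beta forces beta(a) = - (H a, a) < 0, and this is where the sign
    of A[phi](x0) enters.

    The other obstacle is that minimality bounds a weak gradient almost everywhere, while the
    contradiction needs a bound at one touching point. Convolution does not commute with fields of
    variable coefficients. The commutator is estimated through the oscillation of u at the scale of
    the mollifier, so continuity of u is enough and no Euclidean Lipschitz bound is required. *)

Lemma norm_rV_le x (r : R) : 0 <= r ->
  (forall j, `|x ord0 j| <= r) -> `|x| <= r.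
Proof.
move=> r0 xr; rewrite [leLHS]/normr /= mx_normrE; apply/bigmax_leP; split=> //.
by move=> [i j] _ /=; rewrite ord1.
Qed.

Lemma norm_rV_lt x (r : R) : 0 < r ->
  (forall j, `|x ord0 j| < r) -> `|x| < r.
Proof.
move=> r0 xr; rewrite [ltLHS]/normr /= mx_normrE; apply/bigmax_ltP; split=> //.
by move=> [i j] _ /=; rewrite ord1.
Qed.

Lemma coord_norm_le x j : `|x ord0 j| <= `|x|.
Proof.
rewrite [leRHS]/normr /= mx_normrE.
by apply: (@le_bigmax _ _ _ 0 (fun ij : 'I_1 * 'I_n => `|x ij.1 ij.2|) (ord0, j)).
Qed.

Definition row_box (a b : 'rV[R]_n) : set 'rV[R]_n :=
  [set x | forall j, `]a ord0 j, b ord0 j[%classic (x ord0 j)].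

(** The norm of a row is the maximum over its coordinates, so balls are among the boxes on which the
    product measure is explicit. *)
Lemma ball_row_box x r : 0 < r ->
  ball x r = row_box (x - const_mx r) (x + const_mx r).
Proof.
move=> r0; rewrite -ball_normE; apply/seteqP; split=> y /=.
  move=> xy j /=; rewrite in_itv /= !mxE -ltr_distlC -opprB normrN distrC.
  by apply: le_lt_trans xy; have := coord_norm_le (x - y) j; rewrite !mxE.
move=> H; apply: norm_rV_lt => // j; rewrite !mxE.
have := H j; rewrite /= in_itv/= !mxE -ltr_distlC; by [].
Qed.

Lemma measurable_row_box a b : measurable (row_box a b).
Proof.
apply: (@measurable_rV_box R n (fun j => `]a ord0 j, b ord0 j[%classic)) => j.
exact: measurable_itv.
Qed.

Lemma rV_dense_rat x (e : R) : 0 < e -> exists q : 'rV[rat]_n, `|x - map_mx ratr q| < e.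
Proof.
move=> e0.
have H j : exists q : rat, `|x ord0 j - ratr q| < e.
  have [|q /itvP qin] := rat_in_itvoo (_ : x ord0 j - e < x ord0 j + e).
    by lra.
  by exists q; rewrite ltr_distlC ?qin.
have [f fP] := choice H.
exists (\row_j f j); apply: norm_rV_lt => // j; rewrite !mxE; exact: fP.
Qed.

(** Rational centres and radii suffice. The closed balls are kept inside U for the fundamental
    lemma, whose test functions need compact support in U. *)
Lemma open_bigcup_ball U : open U -> exists (q : nat -> 'rV[R]_n) (r : nat -> R),
  U = \bigcup_k ball (q k) (r k) /\
  forall k, closed_ball_ normr (q k) (r k) `<=` U.
Proof.
move=> oU.
pose good (p : 'rV[rat]_n * rat) :=
  closed_ball_ normr (map_mx ratr p.1 : 'rV[R]_n) (ratr p.2) `<=` U.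
(* Indices that code no admissible ball get radius -1, for which even the closed ball is empty. *)
pose Q k : 'rV[R]_n * R := match unpickle k with
  | Some p => if `[< good p >] then (map_mx ratr p.1, ratr p.2) else (0, -1)
  | None => (0, -1) end.
have QU k : closed_ball_ normr (Q k).1 (Q k).2 `<=` U.
  have cb0 : closed_ball_ normr (0 : 'rV[R]_n) (-1) `<=` U.
    by move=> y /= h; have := le_trans (normr_ge0 _) h; rewrite ler0N1.
  rewrite /Q; case: unpickle => [p|]//; case: asboolP => //.
exists (fun k => (Q k).1), (fun k => (Q k).2); split => //.
apply/seteqP; split=> x; last first.
  move=> [k _]; rewrite -ball_normE => xk; apply: (QU k); exact: ltW.
move=> Ux; have /nbhs_ballP[e /= e0 eU] : nbhs x U by exact: open_nbhs_nbhs.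
have [r /itvP rin] := rat_in_itvoo (divr_gt0 e0 (ltr0n R 2)).
have r0 : 0 < ratr r :> R by rewrite rin.
have re : ratr r < e / 2 :> R by rewrite rin.
have [q qx] := rV_dense_rat x r0.
exists (pickle (q, r)) => //; rewrite /Q pickleK.
have -> : `[< good (q, r) >].
  apply/asboolP => y /= qy; apply: eU; rewrite -ball_normE /=.
  rewrite -(subrK (map_mx ratr q) x) -addrA.
  rewrite (splitr e); apply: (le_lt_trans (ler_normD _ _)).
  by apply: ltrD; [exact: lt_trans qx re|exact: le_lt_trans qy re].
by rewrite -ball_normE /= distrC.
Qed.

Lemma open_measurable_rV U : open U -> measurable U.
Proof.
move=> /open_bigcup_ball[q [r [-> _]]]; apply: bigcupT_measurable => k.
have [r0|r0] := ltP 0 (r k).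
  by rewrite ball_row_box//; exact: measurable_row_box.
rewrite (_ : ball _ _ = set0); first exact: measurable0.
apply/seteqP; split=> // y; rewrite -ball_normE /= => h.
by have := le_lt_trans (normr_ge0 _) h; rewrite ltNge r0.
Qed.

Lemma closed_measurable_rV A : closed A -> measurable A.
Proof.
by move=> /closed_openC/open_measurable_rV/measurableC; rewrite setCK.
Qed.

Lemma compact_measurable_rV A : compact A -> measurable A.
Proof.
by move=> /(compact_closed (@norm_hausdorff _ _))/closed_measurable_rV.
Qed.

Lemma continuous_measurable_rV U (f : 'rV[R]_n -> R) : open U ->
  (forall x, U x -> {for x, continuous f}) ->
  measurable_fun U (f : _ -> measurableTypeR R).
Proof.
move=> oU cf; apply: (measurability _ (RGenOInfty.measurableE R)) => _ [_ [c ->] <-].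
apply: open_measurable_rV; rewrite openE => x [Ux /=]; rewrite in_itv/= andbT => cx.
rewrite /interior; near=> y.
split; first by near: y; exact: open_nbhs_nbhs.
rewrite /= in_itv /= andbT; near: y; exact: (cvgr_gt _ (cf _ Ux)).
Unshelve. all: by end_near. Qed.

Lemma compact_closed_ball_rV x r : compact (closed_ball_ normr x r).
Proof.
apply: bounded_closed_compact.
  exists (`|x| + r); split; first exact: num_real.
  move=> M xM y /= xy; rewrite -(subKr x y).
  apply: le_trans (ler_normB _ _) _; apply: ltW; apply: le_lt_trans xM.
  by rewrite lerD2l.
exact: closed_closed_ball_.
Qed.

End row_topology.

(** * Lebesgue measure on row vectors *)

Section row_measure.
Context {R : realType} {n : nat}.
Implicit Types (x y v a b : 'rV[R]_n) (U A : set 'rV[R]_n).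

Definition row_boxes : set (set 'rV[R]_n) := [set row_box ab.1 ab.2 | ab in setT].

(** Boxes, unlike coordinate slabs, are stable under intersection; uniqueness of measures and the
    Dynkin argument below need such a generating family. *)
Lemma measurable_row_boxesE : measurable = <<s row_boxes >>.
Proof.
rewrite eqEsubset; split; last first.
  by apply: smallest_sub => [|_ [ab _ <-]];
    [exact: sigma_algebra_measurable|exact: measurable_row_box].
apply: smallest_sub; first exact: smallest_sigma_algebra.
move=> B; rewrite -bigcup_seq => -[i _ [C mC <-]]; rewrite setTI.
have : measurable_fun setT ((fun x => x ord0 i) : g_sigma_algebraType row_boxes -> measurableTypeR R).
  apply: (measurability _ (RGenOpens.measurableE R)) => _ [_ [c [d ->]] <-].
  (* A slab in one coordinate is the union of the boxes whose other sides are []-k, k[]. *)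
  rewrite setTI (_ : _ @^-1` _ = \bigcup_k
    row_box (\row_j (if j == i then c else - k%:R))
            (\row_j (if j == i then d else k%:R))); last first.
    apply/seteqP; split=> [x xcd|x [k _ /(_ i)]]; last by rewrite /= !mxE eqxx.
    exists (Num.bound `|x|) => // j.
    rewrite /= !mxE; case: eqP => [->//|_]; rewrite in_itv/= -ltr_norml.
    by apply: le_lt_trans (coord_norm_le _ _) (archi_boundP (normr_ge0 x)).
  apply: (@sigma_algebra_bigcup _ setT row_boxes) => k.
  apply: sub_sigma_algebra.
  by exists (\row_j (if j == i then c else - k%:R), \row_j (if j == i then d else k%:R)).
by move=> /(_ measurableT C mC); rewrite setTI.
Qed.

Lemma row_boxI a b c d : row_box a b `&` row_box c d =
  row_box (\row_j Num.max (a ord0 j) (c ord0 j)) (\row_j Num.min (b ord0 j) (d ord0 j)).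
Proof.
apply/seteqP; split=> x /=.
  move=> [H1 H2] j; move: (H1 j) (H2 j); rewrite /= !in_itv/= !mxE gt_max lt_min.
  by move=> /andP[H3 H4] /andP[H5 H6]; rewrite H3 H4 H5 H6.
by move=> H; split=> j; have := H j; rewrite /= !in_itv/= !mxE gt_max lt_min;
  move=> /andP[/andP[H1 H2] /andP[H3 H4]]; apply/andP.
Qed.

Lemma setI_closed_row_boxes : setI_closed row_boxes.
Proof.
move=> _ _ [[a b] _ <-] [[c d] _ <-] /=; rewrite row_boxI.
by exists (\row_j Num.max (a ord0 j) (c ord0 j), \row_j Num.min (b ord0 j) (d ord0 j)).
Qed.

Lemma bigcup_row_box : \bigcup_k row_box (- const_mx k%:R) (const_mx k%:R) = setT :> set 'rV[R]_n.
Proof.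
apply/seteqP; split=> // x _; exists (Num.bound `|x|) => // j.
rewrite /= in_itv/= !mxE -ltr_norml.
by apply: le_lt_trans (coord_norm_le _ _) (archi_boundP (normr_ge0 x)).
Qed.

Lemma lebesgue_row_box a b : lebesgue_rV n (row_box a b) =
  (\prod_(j < n) Num.max 0 (b ord0 j - a ord0 j))%:E.
Proof.
rewrite (@lebesgue_rV_box R n (fun j => `]a ord0 j, b ord0 j[%classic))//.
rewrite -prodEFin; apply: eq_bigr => j _; rewrite lebesgue_measure_itv/= lte_fin.
case: ltP => ab; first by rewrite -EFinB max_r// subr_ge0 ltW.
by rewrite max_l// subr_le0.
Qed.

Lemma measurable_shift v : measurable_fun setT (fun x => x + v).
Proof.
apply: measurable_fun_rowP => j.
under eq_fun do rewrite mxE.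
by apply: measurable_funD => //; exact: measurable_coor.
Qed.

Lemma lebesgue_row_box_fin a b : (lebesgue_rV n (row_box a b) < +oo)%E.
Proof. by rewrite lebesgue_row_box ltry. Qed.

(** Translation keeps the side lengths of boxes, and the boxes with sides []-k, k[] exhaust the
    space with finite measure, so uniqueness of measures applies. *)
Lemma lebesgue_shift v A : measurable A ->
  pushforward (lebesgue_rV n) (fun x => x + v) A = lebesgue_rV n A.
Proof.
have boxE a b : lebesgue_rV n ((fun x => x + v) @^-1` row_box a b) =
    lebesgue_rV n (row_box a b).
  rewrite (_ : _ @^-1` _ = row_box (a - v) (b - v)).
    rewrite !lebesgue_row_box; congr EFin; apply: eq_bigr => j _; rewrite !mxE.
    by congr Num.max; ring.
  apply/seteqP; split=> x /= H j; have := H j; rewrite /= !in_itv/= !mxE.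
    by rewrite ltrBlDr ltrBrDr.
  by rewrite ltrBlDr ltrBrDr.
move=> mA; apply: (measure_unique row_boxes
  (fun k => row_box (- const_mx k%:R) (const_mx k%:R)) measurable_row_boxesE
  setI_closed_row_boxes) => //.
- by move=> k; exists (- const_mx k%:R, const_mx k%:R).
- exact: bigcup_row_box.
- exact: measurable_shift.
- by move=> ms _ [[a b] _ <-]; exact: boxE.
- move=> ms k; have := lebesgue_row_box_fin (- const_mx k%:R) (const_mx k%:R).
  by rewrite -boxE.
Qed.

Lemma Rintegral_shift v (f : 'rV[R]_n -> R) :
  measurable_fun setT (f : _ -> measurableTypeR R) ->
  (lebesgue_rV n).-integrable setT (EFin \o (fun x => f (x + v))) ->
  \int[lebesgue_rV n]_x f (x + v) = \int[lebesgue_rV n]_x f x.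
Proof.
move=> mf intf; rewrite /Rintegral; congr fine.
have E := integral_pushforward (measurable_shift v)
  ((measurable_EFinP _ _).2 mf) intf measurableT.
rewrite -[LHS]E; apply: eq_measure_integral; first exact: measurable_shift.
by move=> ms A mA _; exact: lebesgue_shift.
Qed.

Lemma lebesgue_closed_ball_fin x r : (lebesgue_rV n (closed_ball_ normr x r) < +oo)%E.
Proof.
apply: le_lt_trans (lebesgue_row_box_fin (x - const_mx (r + 1)) (x + const_mx (r + 1))).
apply: le_measure; rewrite ?inE.
- by apply: compact_measurable_rV; exact: compact_closed_ball_rV.
- exact: measurable_row_box.
move=> y /= xy j; rewrite /= in_itv/= !mxE -ltr_distlC.
have := coord_norm_le (x - y) j; rewrite !mxE => h.
by apply: le_lt_trans h _; apply: le_lt_trans xy _; rewrite ltrDl.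
Qed.

Let lt_norm_add1 (M : R) : M < `|M| + 1.
Proof. by rewrite (le_lt_trans (ler_norm M))// ltrDl. Qed.

Lemma compact_sub_closed_ball (K : set 'rV[R]_n) : compact K ->
  exists2 r : R, 0 <= r & K `<=` closed_ball_ normr 0 r.
Proof.
move=> /compact_bounded[M [_ Mb]]; exists (`|M| + 1) => [|x Kx /=]; first by rewrite addr_ge0.
rewrite /closed_ball_/= sub0r normrN; by apply: Mb => //; exact: lt_norm_add1.
Qed.

Lemma lebesgue_compact_fin (K : set 'rV[R]_n) : compact K -> (lebesgue_rV n K < +oo)%E.
Proof.
move=> cK; have [r _ Kr] := compact_sub_closed_ball cK.
apply: le_lt_trans (lebesgue_closed_ball_fin 0 r); apply: le_measure; rewrite ?inE//.
  exact: compact_measurable_rV.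
by apply: compact_measurable_rV; exact: compact_closed_ball_rV.
Qed.

Lemma continuous_compact_bounded (W : normedModType R) (K : set 'rV[R]_n) (f : 'rV[R]_n -> W) :
  compact K -> (forall x, K x -> {for x, continuous f}) ->
  exists2 C : R, 0 <= C & forall x, K x -> `|f x| <= C.
Proof.
move=> cK cf; have : compact (f @` K).
  apply: continuous_compact => //; apply: continuous_in_subspaceT => x /set_mem.
  exact: cf.
move=> /compact_bounded[M [_ Mb]]; exists (`|M| + 1) => [|x Kx]; first by rewrite addr_ge0.
by apply: Mb; [exact: lt_norm_add1|exists x].
Qed.

Lemma bounded_compact_integrable (K : set 'rV[R]_n) (f : 'rV[R]_n -> R) C :
  compact K -> measurable_fun K (f : _ -> measurableTypeR R) ->
  (forall x, K x -> `|f x| <= C) ->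
  (lebesgue_rV n).-integrable K (EFin \o f).
Proof.
move=> cK mf fC; apply: measurable_bounded_integrable => //.
- exact: compact_measurable_rV.
- exact: lebesgue_compact_fin.
exists C; split; first exact: num_real.
by move=> M CM x /= Kx; apply: le_trans (fC x Kx) (ltW CM).
Qed.

Lemma continuous_compact_integrable U (K : set 'rV[R]_n) (f : 'rV[R]_n -> R) :
  open U -> (forall x, U x -> {for x, continuous f}) -> compact K -> K `<=` U ->
  (lebesgue_rV n).-integrable K (EFin \o f).
Proof.
move=> oU cf cK KU.
have [C C0 fC] := continuous_compact_bounded cK (fun x Kx => cf x (KU x Kx)).
apply: bounded_compact_integrable fC => //.
apply: measurable_funS KU _; first exact: open_measurable_rV.
exact: continuous_measurable_rV.
Qed.

Lemma integrable_support (K D : set 'rV[R]_n) (f : 'rV[R]_n -> R) :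
  measurable K -> measurable D -> K `<=` D -> (forall x, ~ K x -> f x = 0) ->
  (lebesgue_rV n).-integrable K (EFin \o f) ->
  (lebesgue_rV n).-integrable D (EFin \o f).
Proof.
move=> mK mD KD f0 intf; have := intf; rewrite (integrable_mkcond _ mK) => intK.
apply: integrableS measurableT mD _ _ => //.
rewrite (_ : EFin \o f = (EFin \o f) \_ K)//.
apply/funext => x; rewrite patchE; case: ifPn => // /negP xK /=.
by rewrite f0// => Kx; apply: xK; rewrite inE.
Qed.

Lemma Rintegral_support (K D : set 'rV[R]_n) (f : 'rV[R]_n -> R) :
  K `<=` D -> (forall x, ~ K x -> f x = 0) ->
  \int[lebesgue_rV n]_(x in D) f x = \int[lebesgue_rV n]_x f x.
Proof.
move=> KD f0; rewrite Rintegral_mkcond; apply: eq_Rintegral => x _.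
rewrite patchE; case: ifPn => // /negP xD.
by rewrite f0// => /KD Dx; apply: xD; rewrite inE.
Qed.

End row_measure.

(** * Divergence theorem *)

Section row_calculus.
Context {R : realType} {n : nat}.
Implicit Types (x y v : 'rV[R]_n) (U K : set 'rV[R]_n) (f g : 'rV[R]_n -> R).

Lemma line_derive f x v (t : R) : derivable f (x + t *: v) v ->
  is_derive t 1 (fun s : R => f (x + s *: v)) ('D_v f (x + t *: v)).
Proof.
move=> df.
have E : (fun h : R => h^-1 *: ((fun s : R => f (x + s *: v)) (h *: (1 : R) + t) - f (x + t *: v)))
  = (fun h => h^-1 *: (f (h *: v + (x + t *: v)) - f (x + t *: v))).
  apply/funext => h; congr (_ *: (f _ - _)).
  by rewrite scalerDl [h *: 1]mulr1 addrCA.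
by split; [rewrite /derivable/= E|rewrite /derive/= E].
Qed.

Lemma derive_linear f x : differentiable f x ->
  forall v, 'D_v f x = \sum_(j < n) v ord0 j * 'D_(delta_mx ord0 j) f x.
Proof.
move=> df v; rewrite deriveE// {1}(row_sum_delta v) linear_sum.
by apply: eq_bigr => j _; rewrite linearZ /= deriveE.
Qed.

Lemma derive_support K f v : closed K -> (forall x, ~ K x -> f x = 0) ->
  forall x, ~ K x -> 'D_v f x = 0.
Proof.
move=> cK f0 x Kx; rewrite (@near_eq_derive _ _ _ _ (cst 0)) ?derive_cst//.
have : nbhs x (~` K) by apply: open_nbhs_nbhs; split => //; exact: closed_openC.
by apply: filterS => y /= /f0.
Qed.

Lemma segment_mean_value f x v (C : R) :
  (forall t : R, 0 <= t <= 1 -> differentiable f (x + t *: v)) ->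
  (forall t : R, 0 <= t <= 1 -> `|'D_v f (x + t *: v)| <= C) ->
  `|f (x + v) - f x| <= C.
Proof.
move=> df fC; pose F (s : R) := f (x + s *: v).
have dF (t : R) : 0 <= t <= 1 -> is_derive t 1 F ('D_v f (x + t *: v)).
  by move=> /df ?; apply: line_derive; exact: diff_derivable.
have [|||c /=] := @MVT_segment R F (fun t => 'D_v f (x + t *: v)) 0 1.
- exact: ler01.
- by move=> t; rewrite in_itv/= => /andP[/ltW t0 /ltW t1]; apply: dF; rewrite t0.
- apply: continuous_in_subspaceT => t; rewrite inE /= in_itv/= => /dF [dt _].
  by apply: differentiable_continuous; exact/derivable1_diffP.
rewrite in_itv/= => /fC cC; rewrite /F scale1r scale0r addr0 subr0 mulr1 => ->.
exact: cC.
Qed.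

Definition C1_supp K f : Prop :=
  [/\ continuous f, forall x v, derivable f x v, forall v, continuous ('D_v f) &
      compact K /\ forall x, ~ K x -> f x = 0].

Lemma continuous_supp_integrable K f : continuous f -> compact K ->
  (forall x, ~ K x -> f x = 0) ->
  (lebesgue_rV n).-integrable setT (EFin \o f).
Proof.
move=> cf cK f0; apply: (@integrable_support _ _ K) => //.
  exact: compact_measurable_rV.
exact: (continuous_compact_integrable openT (fun x _ => cf x) cK (@subsetT _ _)).
Qed.

Lemma compactly_supported_bounded K f : continuous f -> compact K ->
  (forall x, ~ K x -> f x = 0) -> exists2 C : R, 0 <= C & forall x, `|f x| <= C.
Proof.
move=> cf cK f0.
have [C C0 fC] := continuous_compact_bounded cK (fun x _ => cf x).
exists C => // x; have [/fC//|/f0 ->] := pselect (K x); by rewrite normr0.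
Qed.

(** By translation invariance the integral of f(y + t v) does not depend on t; differentiating under
    the integral sign at t = 0 gives the claim without Fubini. *)
Lemma Rintegral_derive0 K f v : C1_supp K f ->
  \int[lebesgue_rV n]_x 'D_v f x = 0.
Proof.
move=> [cf df cdf [cK f0]].
have clK := compact_closed (@norm_hausdorff _ _) cK.
have df0 := derive_support v clK f0.
have [r r0 Kr] := compact_sub_closed_ball cK.
have [C C0 dfC] := compactly_supported_bounded (cdf v) cK df0.
(* For |t| <= 1 all translates of f are supported in this one compact set, on which a constant
   dominates. *)
pose K' := closed_ball_ normr (0 : 'rV[R]_n) (r + `|v|).
have cK' : compact K' by exact: compact_closed_ball_rV.
have mK' := compact_measurable_rV cK'.
have KK' x (t : R) : `|t| <= 1 -> K (x + t *: v) -> K' x.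
  move=> t1 /Kr; rewrite /K' /closed_ball_/= !sub0r !normrN => h.
  rewrite -(addrK (t *: v) x); apply: (le_trans (ler_normB _ _)).
  by rewrite lerD// normrZ ler_piMl.
pose F (t : R) := \int[lebesgue_rV n]_(y in K') f (y + t *: v).
have cft (t : R) : continuous (fun y => f (y + t *: v)).
  move=> y; apply: (@continuous_comp _ _ _ (fun y => y + t *: v) f); last exact: cf.
  by apply: continuousD; [exact: cvg_id|exact: cst_continuous].
have Fcst (t : R) : `|t| <= 1 -> F t = \int[lebesgue_rV n]_y f y.
  move=> t1; rewrite /F (@Rintegral_support _ _ K')//; last first.
    by move=> x K'x; apply: f0 => /(KK' _ _ t1).
  rewrite Rintegral_shift//.
    exact: (continuous_measurable_rV openT (fun x _ => cf x)).
  apply: (continuous_supp_integrable (K := K')) => //.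
  by move=> x K'x; apply: f0 => /(KK' _ _ t1).
have zI : `](-1), 1[%classic (0 : R) by rewrite /= in_itv/= ltrN10 ltr01.
have ld (t : R) y : is_derive t 1 (fun s : R => f (y + s *: v)) ('D_v f (y + t *: v)).
  by apply: line_derive.
have := @differentiation_under_integral R _ _ (lebesgue_rV n)
  (fun t y => f (y + t *: v)) K' mK' 0 (-1) 1 zI.
rewrite -/F => /(_ _ _ (cst C)) D.
have {D} -> : \int[lebesgue_rV n]_x 'D_v f x = 'D_1 F 0.
  rewrite -derive1E D.
  - have df0' x : ~ K' x -> 'D_v f x = 0.
      move=> K'x; apply: df0 => Kx; apply: K'x; apply: (KK' x 0).
        by rewrite normr0.
      by rewrite scale0r addr0.
    rewrite -[LHS](Rintegral_support (@subset_refl _ K') df0').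
    apply: eq_Rintegral => y _; rewrite partial1of2E.
    by have [_ ->] := ld 0 y; rewrite scale0r addr0.
  - by move=> t _; exact: (continuous_compact_integrable openT (fun x _ => cft t x) cK' (@subsetT _ _)).
  - by move=> t y _ _; have [] := ld t y.
  - by move=> y; exact: C0.
  - apply: (bounded_compact_integrable (C := C)) => //.
    by move=> x _; rewrite /= ger0_norm.
  - by move=> t y _ _; rewrite partial1of2E; have [_ ->] := ld t y.
rewrite (@near_eq_derive _ _ _ _ (cst (\int[lebesgue_rV n]_y f y))).
- by rewrite derive_cst.
near=> t; apply: Fcst; near: t.
by apply: (@nbhs0_le R R^o).
Unshelve. all: by end_near. Qed.

End row_calculus.

(** * Smooth bump functions *)

Section flat_functions.
Context {R : realType}.
Implicit Types (p q : {poly R}) (t s : R).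

(** The polynomial in 1/t makes the family stable under differentiation, so that smoothness to all
    orders follows by induction. *)
Definition flat p t : R := if 0 < t then p.[t^-1] * expR (- t^-1) else 0.

(** Raise s/k <= exp(s/k) to the power k. *)
Lemma exprn_expRN_le (k : nat) (s : R) : 0 <= s -> s ^+ k * expR (- s) <= k%:R ^+ k.
Proof.
case: k => [|k] s0; first by rewrite !expr0 mul1r -expR0 ler_expR oppr_le0.
have k0 : 0 < k.+1%:R :> R by rewrite ltr0n.
rewrite expRN ler_pdivrMr ?expR_gt0//.
have -> : expR s = expR (s / k.+1%:R) ^+ k.+1.
  by rewrite -expRM_natl mulrC divfK ?gt_eqF.
rewrite -exprMn lerXn2r ?nnegrE ?mulr_ge0 ?expR_ge0//.
rewrite -ler_pdivrMl// mulrC; apply: le_trans (expR_ge1Dx _).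
by rewrite lerDr.
Qed.

Lemma horner_expRN_bounded p : exists2 C : R, 0 <= C &
  forall s, 0 <= s -> `|p.[s] * expR (- s)| <= C.
Proof.
exists (\sum_(i < size p) `|p`_i| * i%:R ^+ i) => [|s s0].
  by apply: sumr_ge0 => i _; rewrite mulr_ge0// exprn_ge0.
rewrite horner_coef mulr_suml; apply: (le_trans (ler_norm_sum _ _ _)).
apply: ler_sum => i _; rewrite -mulrA normrM ler_wpM2l// ger0_norm.
  exact: exprn_expRN_le.
by rewrite mulr_ge0 ?expR_ge0// exprn_ge0.
Qed.

Lemma flat_le0 p t : t <= 0 -> flat p t = 0.
Proof. by move=> t0; rewrite /flat ltNge t0. Qed.

(** A factor t can always be split off while the cofactor stays bounded; this gives both the limit
    and the derivative at 0. *)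
Lemma flatMX p t : t * flat (p * 'X) t = flat p t.
Proof.
rewrite /flat; case: ifPn => [t0|_]; last by rewrite mulr0.
by rewrite hornerMX; field; rewrite gt_eqF.
Qed.

Lemma flat_bounded p : exists2 C : R, 0 <= C & forall t, `|flat p t| <= C.
Proof.
have [C C0 pC] := horner_expRN_bounded p; exists C => // t.
rewrite /flat; case: ifPn => [t0|_]; last by rewrite normr0.
by apply: pC; rewrite invr_ge0 ltW.
Qed.

Lemma flat_cvg0 p : flat p t @[t --> (0:R)] --> (0 : R).
Proof.
have [C C0 pC] := flat_bounded (p * 'X).
apply/cvgrPdist_lt => e e0; near=> t.
rewrite sub0r normrN -flatMX normrM.
apply: (@le_lt_trans _ _ (`|t| * (C + 1))).
  by rewrite ler_wpM2l// (le_trans (pC _))// lerDl.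
rewrite -ltr_pdivlMr; last by rewrite ltr_wpDl.
by near: t; apply: (@nbhs0_lt R R^o); rewrite divr_gt0// ltr_wpDl.
Unshelve. all: by end_near. Qed.

(** At 0 the difference quotient of [flat p] is [flat (p * 'X)], which tends to 0. *)
Lemma is_derive_flat p t : is_derive t (1 : R) (flat p) (flat ('X^2 * (p - p^`())) t).
Proof.
have [t0|t0|->] := ltgtP t 0.
- rewrite (flat_le0 _ (ltW t0)); apply: (@near_eq_is_derive _ _ _ (cst 0)).
    near=> s; rewrite flat_le0//; near: s.
    exact: lt_le_nbhsl.
- apply: (@near_eq_is_derive _ _ _ (fun s => p.[s^-1] * expR (- s^-1))).
    near=> s; rewrite /flat ifT//; near: s; exact: lt_nbhsr.
  have t1 : t != 0 by rewrite gt_eqF.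
  have dV : is_derive t (1:R) (fun s : R => s^-1) (- t ^- 2).
    have := @is_deriveV R id t 1 1 t1 (is_derive_id _ _).
    by rewrite /GRing.scale/= mulr1.
  have dE : is_derive t (1:R) (fun s : R => expR (- s^-1)) (t^-2 * expR (- t^-1)).
    have dN : is_derive t (1:R) (fun s : R => - s^-1) (t ^- 2).
      by have := is_deriveN dV; rewrite opprK.
    have := @is_derive1_comp R expR (fun s => - s^-1) t _ _ (is_derive_expR _) dN.
    by rewrite mulrC.
  have dP : is_derive t (1:R) (fun s : R => p.[s^-1]) (- t^-2 * (p^`()).[t^-1]).
    have dp : is_derive t^-1 (1:R) (horner p) (p^`()).[t^-1].
      by apply: DeriveDef; [exact: derivable_horner|rewrite -derive1E -derivE].
    have := @is_derive1_comp R (horner p) (fun s => s^-1) t _ _ dp dV.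
    by rewrite mulrC.
  have H := is_deriveM dP dE. apply: (is_derive_eq H).
  rewrite /flat t0 !hornerE /= /GRing.scale/= -!exprVn; ring.
- rewrite flat_le0//.
  have E : (fun h : R => h^-1 *: (flat p (h *: (1:R) + 0) - flat p 0)) @ 0^' --> (0:R).
    apply/cvgrPdist_lt => e e0.
    have /cvgrPdist_lt/(_ e e0) L := flat_cvg0 (p * 'X).
    near=> h.
    have h0 : h != 0 by near: h; exact: nbhs_dnbhs_neq.
    rewrite addr0 [h *: 1]mulr1 (flat_le0 p (lexx 0)) subr0 -(flatMX p h).
    rewrite /GRing.scale/= mulKf//.
    by near: h; exact: nbhs_dnbhs.
  split; first by apply/cvg_ex; exists 0.
  exact: cvg_lim E.
Unshelve. all: by end_near. Qed.

Lemma flat1_ge0 t : 0 <= flat 1 t.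
Proof. by rewrite /flat; case: ifP => // _; rewrite hornerE mul1r expR_ge0. Qed.

Lemma flat1_gt0 t : 0 < t -> 0 < flat 1 t.
Proof. by rewrite /flat => ->; rewrite hornerE mul1r expR_gt0. Qed.

Lemma flat1_le1 t : flat 1 t <= 1.
Proof.
rewrite /flat; case: ifPn => [t0|_]; last exact: ler01.
by rewrite hornerE ?mul1r -[leRHS]expR0 ler_expR oppr_le0 invr_ge0 ltW.
Qed.

Lemma flat1_homo s t : s <= t -> flat 1 s <= flat 1 t.
Proof.
move=> st; have [s0|s0] := leP s 0; first by rewrite flat_le0// flat1_ge0.
have t0 := lt_le_trans s0 st.
by rewrite /flat s0 t0 !hornerE ?mul1r ler_expR lerN2 lef_pV2.
Qed.

End flat_functions.

(** * Algebra generated by flat functions of the coordinates; bumps supported in boxes *)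

Section flat_algebra.
Context {R : realType} {n : nat}.
Implicit Types (x y v a b : 'rV[R]_n) (f g : 'rV[R]_n -> R).

Lemma is_derive_coord x v j : is_derive x v (fun y : 'rV[R]_n => y ord0 j) (v ord0 j).
Proof.
have dc : derivable (fun y : 'rV[R]_n => y ord0 j) x v.
  by apply: diff_derivable; exact: differentiable_coord.
split => //; have := @derive_mx _ _ 1 n id x v (@derivable_id _ _ _ _).
by rewrite derive_id => /matrixP/(_ ord0 j); rewrite mxE.
Qed.

(** A class containing its own directional derivatives, which makes each member smooth without any
    computation of higher derivatives. *)
Inductive flat_alg : ('rV[R]_n -> R) -> Prop :=
| flat_alg_cst c : flat_alg (fun=> c)
| flat_alg_coord p c d j : flat_alg (fun x => flat p (c + d * x ord0 j))
| flat_algD f g : flat_alg f -> flat_alg g -> flat_alg (fun x => f x + g x)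
| flat_algM f g : flat_alg f -> flat_alg g -> flat_alg (fun x => f x * g x).

Lemma differentiable_flat_coord p (c d : R) j x :
  differentiable (fun x : 'rV[R]_n => flat p (c + d * x ord0 j)) x.
Proof.
apply: (@differentiable_comp _ _ _ _ (fun x : 'rV[R]_n => c + d * x ord0 j) (flat p)).
  apply: differentiableD => //; apply: differentiableZ; exact: differentiable_coord.
by apply/derivable1_diffP; have [] := is_derive_flat p (c + d * x ord0 j).
Qed.

Lemma derive_flat_coord p (c d : R) j x v :
  'D_v (fun x : 'rV[R]_n => flat p (c + d * x ord0 j)) x =
  flat ('X^2 * (p - p^`())) (c + d * x ord0 j) * (d * v ord0 j).
Proof.
have [_] := @line_derive _ _ _ x v 0
  (diff_derivable (differentiable_flat_coord p c d j (x + 0 *: v))).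
rewrite !scale0r !addr0 => <-.
have -> : (fun s : R => flat p (c + d * (x + s *: v) ord0 j)) =
    flat p \o (fun s => (c + d * x ord0 j) + s * (d * v ord0 j)).
  by apply/funext => s /=; congr flat; rewrite !mxE; ring.
have dl : is_derive (0 : R) (1 : R)
    (fun s => (c + d * x ord0 j) + s * (d * v ord0 j)) (d * v ord0 j).
  have H := is_deriveD (is_derive_cst (c + d * x ord0 j) (0:R) (1:R))
    (is_deriveM (is_derive_id (0:R) (1:R)) (is_derive_cst (d * v ord0 j) (0:R) (1:R))).
  apply: (is_derive_eq H).
  by rewrite /GRing.scale/= /cst; ring.
have := @is_derive1_comp _ (flat p) _ 0 _ _ (is_derive_flat p _) dl.
by rewrite mul0r addr0 => -[_ ->].
Qed.

Lemma flat_alg_derive f : flat_alg f ->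
  (forall x, differentiable f x) /\ forall v, flat_alg ('D_v f).
Proof.
elim=> {f} [c|p c d j|f g fA [df Df] gA [dg Dg]|f g fA [df Df] gA [dg Dg]].
- split=> // v; rewrite (_ : 'D_v _ = fun=> 0); first exact: flat_alg_cst.
  by apply/funext => x; rewrite (derive_cst c).
- split=> [x|v]; first exact: differentiable_flat_coord.
  rewrite (_ : 'D_v _ = fun x => flat ('X^2 * (p - p^`())) (c + d * x ord0 j)
      * (d * v ord0 j)).
    by apply: flat_algM; [exact: flat_alg_coord|exact: flat_alg_cst].
  by apply/funext => x; exact: derive_flat_coord.
- split=> [x|v]; first exact: differentiableD.
  rewrite (_ : 'D_v _ = fun x => 'D_v f x + 'D_v g x); first exact: flat_algD.
  by apply/funext => x; rewrite deriveD//; exact: diff_derivable.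
- split=> [x|v]; first exact: differentiableM.
  rewrite (_ : 'D_v _ = fun x => f x * 'D_v g x + g x * 'D_v f x).
    by apply: flat_algD; apply: flat_algM.
  by apply/funext => x; rewrite deriveM//; exact: diff_derivable.
Qed.

Lemma flat_alg_Ck k f : flat_alg f -> Ck k setT f.
Proof.
elim: k f => [|k IH] f fA /=; have [df Df] := flat_alg_derive fA.
  by move=> x _; exact: differentiable_continuous.
by split=> // v; exact: IH.
Qed.

Lemma flat_alg_prod (I : Type) (s : seq I) (F : I -> 'rV[R]_n -> R) :
  (forall i, flat_alg (F i)) -> flat_alg (fun x => \prod_(i <- s) F i x).
Proof.
move=> FA; elim: s => [|i s IH].
  rewrite (_ : (fun _ => _) = fun=> 1); first exact: flat_alg_cst.
  by apply/funext => x; rewrite big_nil.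
rewrite (_ : (fun _ => _) = fun x => F i x * \prod_(j <- s) F j x).
  exact: flat_algM.
by apply/funext => x; rewrite big_cons.
Qed.

(** The parameter k is a steepness: as k grows the bump tends to the indicator of the open box, and
    k = 1/r on the box of half-width r gives the mollifier. *)
Definition bump (k : R) a b x : R :=
  \prod_(j < n) (flat 1 (k * (x ord0 j - a ord0 j)) * flat 1 (k * (b ord0 j - x ord0 j))).

Lemma flat_alg_bump k a b : flat_alg (bump k a b).
Proof.
apply: flat_alg_prod => j; apply: flat_algM.
  rewrite (_ : (fun _ => _) = fun x => flat 1 (- (k * a ord0 j) + k * x ord0 j)).
    exact: flat_alg_coord.
  by apply/funext => x; congr flat; ring.
rewrite (_ : (fun _ => _) = fun x => flat 1 (k * b ord0 j + (- k) * x ord0 j)).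
  exact: flat_alg_coord.
by apply/funext => x; congr flat; ring.
Qed.

Lemma bump_ge0 k a b x : 0 <= bump k a b x.
Proof. by apply: prodr_ge0 => j _; rewrite mulr_ge0 ?flat1_ge0. Qed.

Lemma bump_le1 k a b x : bump k a b x <= 1.
Proof.
apply: (@le_trans _ _ (\prod_(j < n) 1)); last by rewrite big1_eq.
apply: ler_prod => j _; by rewrite mulr_ge0 ?flat1_ge0//= mulr_ile1 ?flat1_ge0 ?flat1_le1.
Qed.

Lemma bump_out k a b x : 0 <= k -> ~ row_box a b x -> bump k a b x = 0.
Proof.
move=> k0 /existsNP[j]; rewrite /= in_itv/= => /negP; rewrite negb_and -!leNgt => H.
rewrite /bump (bigD1 j)//=; case/orP: H => H.
  by rewrite [flat 1 (k * (x _ _ - _))]flat_le0 ?mul0r// mulr_ge0_le0// subr_le0.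
by rewrite [flat 1 (k * (b _ _ - _))]flat_le0 ?mulr0 ?mul0r// mulr_ge0_le0// subr_le0.
Qed.

Definition closed_row_box a b : set 'rV[R]_n :=
  [set x | forall j, `[a ord0 j, b ord0 j]%classic (x ord0 j)].

Lemma compact_closed_row_box a b : compact (closed_row_box a b).
Proof.
apply: (@rV_compact _ _ (fun j => `[a ord0 j, b ord0 j]%classic)) => j.
exact: segment_compact.
Qed.

Lemma row_box_closed a b : row_box a b `<=` closed_row_box a b.
Proof.
by move=> x xab j; have := xab j; rewrite /= !in_itv/= => /andP[/ltW -> /ltW ->].
Qed.

Lemma test_function_bump U k a b : 0 <= k -> closed_row_box a b `<=` U ->
  test_function U (bump k a b).
Proof.
move=> k0 abU; split; first by move=> i; apply: flat_alg_Ck; exact: flat_alg_bump.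
exists (closed_row_box a b); first by split => //; exact: compact_closed_row_box.
by move=> x nx; apply: bump_out => // /row_box_closed.
Qed.

End flat_algebra.

(** * Fundamental lemma of the calculus of variations *)

Section fundamental_lemma.
Context {R : realType} {n : nat}.
Implicit Types (x y v a b : 'rV[R]_n) (U : set 'rV[R]_n) (f g phi : 'rV[R]_n -> R).
Local Notation mu := (lebesgue_rV n).

Lemma bump_cvg1 a b x : row_box a b x -> bump k%:R a b x @[k --> \oo] --> (1 : R).
Proof.
move=> xab.
have flat_cvg (t : R) : 0 < t -> flat 1 (k%:R * t) @[k --> \oo] --> (1 : R).
  (* The index k = 0 is skipped because [flat 1] is not given by the exponential there. *)
  move=> t0; rewrite -cvg_shiftS.
  have -> : (fun k => flat 1 (k.+1%:R * t) : R) = (fun k => expR (- (k.+1%:R^-1 * t^-1))).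
    apply/funext => k; rewrite /flat mulr_gt0 ?ltr0n// hornerE ?mul1r.
    by rewrite invfM.
  have H : - (k.+1%:R^-1 * t^-1) @[k --> \oo] --> - (0 * t^-1).
    by apply: cvgN; apply: cvgM; [exact: cvg_harmonic|exact: cvg_cst].
  rewrite mul0r oppr0 in H.
  have := cvg_comp _ _ H (@continuous_expR R 0).
  by rewrite expR0.
suff : forall s : seq 'I_n, \prod_(j <- s) (flat 1 (k%:R * (x ord0 j - a ord0 j)) *
    flat 1 (k%:R * (b ord0 j - x ord0 j))) @[k --> \oo] --> (1 : R) by apply.
elim=> [|j s IH].
  by under eq_fun do rewrite big_nil; exact: cvg_cst.
under eq_fun do rewrite big_cons.
have := xab j; rewrite /= in_itv/= -subr_gt0 -(subr_gt0 (x ord0 j)) => /andP[xa xb].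
have H := cvgM (cvgM (flat_cvg _ xa) (flat_cvg _ xb)) IH.
by rewrite !mulr1 in H; exact: H.
Qed.

(** Bump functions approximate the indicator function of a box. *)
Lemma orthogonal_test_box U g a b : open U -> loc_integrable U g ->
  (forall phi, test_function U phi -> \int[mu]_(x in U) (g x * phi x) = 0) ->
  closed_row_box a b `<=` U -> (\int[mu]_(x in row_box a b) (g x)%:E = 0)%E.
Proof.
move=> oU ig gphi abU.
have mQ := measurable_row_box a b.
have igQ : mu.-integrable (row_box a b) (EFin \o g).
  have cQ := @compact_closed_row_box R n a b.
  apply: (integrableS (compact_measurable_rV cQ) mQ (@row_box_closed _ _ a b)).
  exact: ig.
have mg : measurable_fun (row_box a b) (g : _ -> measurableTypeR R).
  by apply/measurable_EFinP; exact: measurable_int igQ.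
pose f_ (k : nat) := EFin \o (fun x => g x * bump k%:R a b x).
have mbump k : measurable_fun (row_box a b) (bump k a b : _ -> measurableTypeR R).
  apply: (measurable_funS measurableT (@subsetT _ _)).
  have [db _] := flat_alg_derive (flat_alg_bump k a b).
  apply: (continuous_measurable_rV openT) => x _.
  exact: differentiable_continuous.
have [|||||_ _] := @dominated_convergence _ _ _ mu _ mQ f_ (EFin \o g) (abse \o (EFin \o g)).
- by move=> k; apply/measurable_EFinP; apply: measurable_funM; [exact: mg|exact: mbump].
- exact/measurable_EFinP.
- apply: aeW => x xab; apply: cvg_EFin; first exact: nearW.
  have H := cvgM (cvg_cst (g x)) (bump_cvg1 xab).
  by rewrite mulr1 in H; exact: H.
- exact: integrable_abse.
- apply: aeW => x k _; rewrite /= lee_fin normrM ler_piMr//.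
  by rewrite ger0_norm ?bump_ge0 ?bump_le1.
suff : forall k, (\int[mu]_(x in row_box a b) f_ k x = 0)%E.
  move=> f0; under eq_fun do rewrite f0.
  by move/(cvg_unique _ (cvg_cst 0%E)) => /= <-.
move=> k.
have out x : ~ row_box a b x -> g x * bump k%:R a b x = 0.
  by move=> nx; rewrite bump_out ?mulr0.
have : \int[mu]_(x in row_box a b) (g x * bump k%:R a b x) = 0.
  rewrite (Rintegral_support (@subset_refl _ _) out).
  rewrite -(Rintegral_support (fun x xab => abU x (row_box_closed xab)) out).
  by apply: gphi; exact: test_function_bump.
rewrite /Rintegral => I0; rewrite -[LHS]fineK; first by rewrite I0.
apply: integrable_fin_num => //.
apply: le_integrable igQ => //; first by apply/measurable_EFinP; apply: measurable_funM; [exact: mg|exact: mbump].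
move=> x _; rewrite /= lee_fin normrM ler_piMr//.
by rewrite ger0_norm ?bump_ge0 ?bump_le1.
Qed.

(** The measurable sets A with zero integral of g over A and the box form a Dynkin system containing
    all boxes, hence contain every measurable set. *)
Lemma box_orthogonal_ae0 g a b :
  mu.-integrable (row_box a b) (EFin \o g) ->
  (forall c d : 'rV[R]_n, (forall j, a ord0 j <= c ord0 j /\ d ord0 j <= b ord0 j) ->
    (\int[mu]_(x in row_box c d) (g x)%:E = 0)%E) ->
  {ae mu, forall x, row_box a b x -> g x = 0}.
Proof.
move=> ig g0; have mQ := measurable_row_box a b.
have mg : measurable_fun (row_box a b) (EFin \o g) by exact: measurable_int ig.
pose H A := measurable A /\ (\int[mu]_(x in A `&` row_box a b) (g x)%:E = 0)%E.
have HT : H setT by split; [exact: measurableT|rewrite setTI; apply: g0 => j; rewrite !lexx].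
have dH : dynkin H.
  split=> //.
  - move=> A [mA A0]; split; first exact: measurableC.
    have := g0 a b (fun j => conj (lexx _) (lexx _)).
    rewrite -{1}[row_box a b]setTI -(setUv A) setIUl.
    rewrite integral_setU_EFin ?A0 ?add0e//.
    + exact: measurableI.
    + by apply: measurableI => //; exact: measurableC.
    + by rewrite -setIUl setUv setTI; exact/measurable_EFinP.
    + by apply/disj_setPS => x [[Ax _] [nAx _]].
  - move=> F tF HF; split; first by apply: bigcupT_measurable => k; have [] := HF k.
    have mF k : measurable (F k `&` row_box a b).
      by apply: measurableI => //; have [] := HF k.
    rewrite setI_bigcupl integral_bigcup//.
    + by apply: eseries0 => k _ _; have [] := HF k.
    + exact: trivIset_setIr.
    + rewrite -setI_bigcupl; apply: integrableS ig => //.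
      by apply: measurableI => //; apply: bigcupT_measurable => k; have [] := HF k.
have all_zero A : measurable A -> H A.
  rewrite measurable_row_boxesE -(setI_closed_g_dynkin_g_sigma_algebra setI_closed_row_boxes).
  apply: smallest_sub => // _ [[c d] _ <-] /=.
  split; first exact: measurable_row_box.
  by rewrite row_boxI; apply: g0 => j; rewrite !mxE le_max ge_min !lexx !orbT.
have : ae_eq mu (row_box a b) (EFin \o g) (cst 0%E).
  apply: integral_ae_eq => // E EQ mE.
  have [_] := all_zero _ mE; rewrite (setIidl EQ) => ->.
  by rewrite integral0.
by apply: filterS => x h /h [].
Qed.

Lemma ae_bigcup (P : nat -> set 'rV[R]_n) (Q : 'rV[R]_n -> Prop) :
  (forall k, {ae mu, forall x, P k x -> Q x}) ->
  {ae mu, forall x, (\bigcup_k P k) x -> Q x}.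
Proof.
move=> h; apply: (negligibleS _ (negligible_bigcup h)).
by move=> x /= /not_implyP[[k _ Pk] nQ]; exists k => // /(_ Pk); exact: nQ.
Qed.

(** Countably many boxes with closure in U cover U, and on each of them g is orthogonal to the
    indicators of all smaller boxes. *)
Lemma fundamental_lemma U g : open U -> loc_integrable U g ->
  (forall phi, test_function U phi -> \int[mu]_(x in U) (g x * phi x) = 0) ->
  {ae mu, forall x, U x -> g x = 0}.
Proof.
move=> oU ig gphi; have [q [r [UE rU]]] := open_bigcup_ball oU.
suff H : {ae mu, forall x, (\bigcup_k ball (q k) (r k)) x -> g x = 0}.
  by apply: filterS H => x Hx Ux; apply: Hx; rewrite -UE.
apply: ae_bigcup => k.
have [r0|r0] := ltP 0 (r k); last first.
  apply: aeW => x; rewrite -ball_normE => /= h.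
  by have := le_lt_trans (normr_ge0 _) h; rewrite ltNge r0.
have cU : closed_row_box (q k - const_mx (r k)) (q k + const_mx (r k)) `<=` U.
  move=> x xQ; apply: (rU k); apply: norm_rV_le; first exact: ltW.
  move=> j; have := xQ j; rewrite /= in_itv/= !mxE => /andP[H1 H2].
  by rewrite ler_distlC H1 H2.
rewrite ball_row_box//; apply: box_orthogonal_ae0.
  have cQ := @compact_closed_row_box R n (q k - const_mx (r k)) (q k + const_mx (r k)).
  apply: (integrableS (compact_measurable_rV cQ) (measurable_row_box _ _) (@row_box_closed _ _ _ _)).
  exact: ig.
move=> c d cd; apply: orthogonal_test_box oU ig gphi _ => x xcd; apply: cU => j.
have [ac db] := cd j; have := xcd j; rewrite /= !in_itv/= => /andP[cx xd].
by rewrite (le_trans ac cx) (le_trans xd db).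
Qed.

End fundamental_lemma.

(** * Functions of class C^1 *)

Section C1_functions.
Context {R : realType} {n : nat}.
Implicit Types (x y v : 'rV[R]_n) (U K : set 'rV[R]_n) (f g h phi : 'rV[R]_n -> R).

Lemma near_eq_continuous f g x : (\near x, f x = g x) ->
  {for x, continuous g} -> {for x, continuous f}.
Proof.
move=> fg cg; rewrite /prop_for /continuous_at (nbhs_singleton fg).
apply: cvg_trans cg; apply: (@near_eq_cvg _ _ (nbhs x) _ g f); near=> y; apply/esym; near: y.
exact: fg.
Unshelve. all: by end_near. Qed.

Lemma eq_on_continuous U f g x : open U -> (forall y, U y -> f y = g y) -> U x ->
  {for x, continuous g} -> {for x, continuous f}.
Proof.
move=> oU fg Ux; apply: near_eq_continuous.
by apply: filterS (open_nbhs_nbhs (conj oU Ux)) => y /fg.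
Qed.

Lemma eq_on_derive U f g x v : open U -> (forall y, U y -> f y = g y) -> U x ->
  'D_v f x = 'D_v g x.
Proof.
move=> oU fg Ux; apply: near_eq_derive.
by apply: filterS (open_nbhs_nbhs (conj oU Ux)) => y /fg.
Qed.

Lemma Ck1_continuous U f x : Ck 1 U f -> U x -> {for x, continuous f}.
Proof. by move=> [df _] /df; exact: differentiable_continuous. Qed.

Lemma Ck1W (W : normedModType R) U (f : 'rV[R]_n -> W) : Ck 2 U f -> Ck 1 U f.
Proof.
move=> [df d2]; split=> // v x Ux; have [dd _] := d2 v.
exact: differentiable_continuous (dd x Ux).
Qed.

Lemma Ck1_sub (W : normedModType R) U K (f : 'rV[R]_n -> W) : K `<=` U -> Ck 1 U f -> Ck 1 K f.
Proof. by move=> KU [df cf]; split=> [x /KU/df//|v x Kx]; exact: cf v x (KU x Kx). Qed.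

Lemma Ck1_cst U (c : R) : Ck 1 U (fun=> c).
Proof.
split=> [x _|v x _]; first exact: differentiable_cst.
rewrite (_ : 'D_v _ = fun=> 0); first exact: cst_continuous.
by apply/funext => y; rewrite (derive_cst c).
Qed.

Lemma Ck1_coordinate U (j : 'I_n) : Ck 1 U (fun x => x ord0 j).
Proof.
split=> [x _|v x _]; first exact: differentiable_coord.
rewrite (_ : 'D_v _ = fun=> v ord0 j); first exact: cst_continuous.
by apply/funext => y; have [_ ->] := is_derive_coord y v j.
Qed.

Lemma Ck1D U f g : open U -> Ck 1 U f -> Ck 1 U g -> Ck 1 U (fun x => f x + g x).
Proof.
move=> oU [df cf] [dg cg]; split=> [x Ux|v x Ux].
  by apply: differentiableD; [exact: df|exact: dg].
apply: (@eq_on_continuous U _ (fun x => 'D_v f x + 'D_v g x)) => //.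
  by move=> y Uy; rewrite deriveD//; apply: diff_derivable; [exact: df|exact: dg].
exact: cvgD (cf v x Ux) (cg v x Ux).
Qed.

Lemma Ck1M U f g : open U -> Ck 1 U f -> Ck 1 U g -> Ck 1 U (fun x => f x * g x).
Proof.
move=> oU fC gC; have [df cf] := fC; have [dg cg] := gC; split=> [x Ux|v x Ux].
  by apply: differentiableM; [exact: df|exact: dg].
apply: (@eq_on_continuous U _ (fun x => f x * 'D_v g x + g x * 'D_v f x)) => //.
  by move=> y Uy; rewrite deriveM//; apply: diff_derivable; [exact: df|exact: dg].
exact: cvgD (cvgM (Ck1_continuous fC Ux) (cg v x Ux))
  (cvgM (Ck1_continuous gC Ux) (cf v x Ux)).
Qed.

Lemma continuous_at_sum (I : Type) (s : seq I) (F : I -> 'rV[R]_n -> R) x :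
  (forall i, {for x, continuous (F i)}) ->
  {for x, continuous (fun y => \sum_(i <- s) F i y)}.
Proof.
move=> cF; elim: s => [|i s IH].
  rewrite (_ : (fun _ => _) = fun=> 0); first exact: cst_continuous.
  by apply/funext => y; rewrite big_nil.
rewrite (_ : (fun _ => _) = fun y => F i y + \sum_(j <- s) F j y).
  exact: cvgD (cF i) IH.
by apply/funext => y; rewrite big_cons.
Qed.

Lemma Ck1_sum U (I : Type) (s : seq I) (F : I -> 'rV[R]_n -> R) : open U ->
  (forall i, Ck 1 U (F i)) -> Ck 1 U (fun x => \sum_(i <- s) F i x).
Proof.
move=> oU FC; elim: s => [|i s IH].
  rewrite (_ : (fun _ => _) = fun=> 0); first exact: Ck1_cst.
  by apply/funext => x; rewrite big_nil.
rewrite (_ : (fun _ => _) = fun x => F i x + \sum_(j <- s) F j x).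
  exact: Ck1D.
by apply/funext => x; rewrite big_cons.
Qed.

Lemma derive_row_coord (Y : 'rV[R]_n -> 'rV[R]_n) x v j : differentiable Y x ->
  'D_v (fun y => Y y ord0 j) x = ('D_v Y x) ord0 j.
Proof. by move=> /diff_derivable dY; rewrite (derive_mx (dY v)) mxE. Qed.

Lemma Ck1_row_coord U (Y : 'rV[R]_n -> 'rV[R]_n) j : open U -> Ck 1 U Y ->
  Ck 1 U (fun y => Y y ord0 j).
Proof.
move=> oU [dY cY]; split=> [x Ux|v x Ux].
  apply: (@differentiable_comp _ _ _ _ Y (fun z : 'rV[R]_n => z ord0 j)).
    exact: dY.
  exact: differentiable_coord.
apply: (@eq_on_continuous U _ (fun y => ('D_v Y y) ord0 j)) => //.
  by move=> y Uy; apply: derive_row_coord; exact: dY.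
apply: (@continuous_comp _ _ _ ('D_v Y) (fun z : 'rV[R]_n => z ord0 j)).
  exact: cY v x Ux.
exact: coord_continuous.
Qed.

Lemma vderivE U (Y : 'rV[R]_n -> 'rV[R]_n) f x : Ck 1 U f -> U x ->
  vderiv Y f x = \sum_(j < n) Y x ord0 j * 'D_(delta_mx ord0 j) f x.
Proof. by move=> [df _] Ux; rewrite /vderiv (derive_linear (df x Ux)). Qed.

(** The direction of differentiation moves with the point, so f is expanded in partial derivatives
    along fixed directions. *)
Lemma vderiv_continuous U (Y : 'rV[R]_n -> 'rV[R]_n) f x : open U ->
  (forall j, Ck 1 U (fun y => Y y ord0 j)) -> Ck 1 U f -> U x ->
  {for x, continuous (vderiv Y f)}.
Proof.
move=> oU YC fC Ux.
apply: (@eq_on_continuous U _ (fun x => \sum_(j < n) Y x ord0 j * 'D_(delta_mx ord0 j) f x)) => //.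
  by move=> y Uy; exact: vderivE fC Uy.
have [_ cf] := fC.
apply: continuous_at_sum => j; exact: cvgM (Ck1_continuous (YC j) Ux) (cf _ x Ux).
Qed.

Lemma test_functionW U phi : test_function U phi ->
  (forall V, Ck 1 V phi) /\
  exists2 K, compact K /\ K `<=` U & forall x, ~ K x -> phi x = 0.
Proof.
move=> [phiC [K KU phi0]]; split; last by exists K.
by move=> V; apply: (Ck1_sub (@subsetT _ V)); exact: (phiC 1).
Qed.

(** Nothing is known of h off U, but the complement of K is open and the product vanishes on it. *)
Lemma C1_supp_test_mul U K phi h : open U -> (forall V, Ck 1 V phi) ->
  compact K -> K `<=` U -> (forall x, ~ K x -> phi x = 0) -> Ck 1 U h ->
  C1_supp K (fun x => phi x * h x).
Proof.
move=> oU phiC cK KU phi0 hC.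
have [dF cF] := Ck1M oU (phiC U) hC.
have clK := compact_closed (@norm_hausdorff _ _) cK.
have F0 x : ~ K x -> phi x * h x = 0 by move=> /phi0 ->; rewrite mul0r.
have oK : open (~` K) by exact: closed_openC.
have nU x : ~ U x -> (~` K) x by move=> nUx /KU.
split=> //.
- move=> x; have [Ux|/nU Kx] := pselect (U x).
    by apply: differentiable_continuous; exact: dF.
  by apply: (@eq_on_continuous (~` K) _ (fun=> 0)) => //; exact: cst_continuous.
- move=> x v; have [Ux|/nU Kx] := pselect (U x).
    by apply: diff_derivable; exact: dF.
  apply: (@near_eq_derivable _ _ _ (cst 0)); last exact: derivable_cst.
  by apply: filterS (open_nbhs_nbhs (conj oK Kx)) => y /F0.
- move=> v x; have [Ux|/nU Kx] := pselect (U x); first exact: cF v x Ux.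
  apply: (@eq_on_continuous (~` K) _ (fun=> 0)) => //; last exact: cst_continuous.
  by move=> y; exact: derive_support clK F0 y.
Qed.

End C1_functions.

(** * Weak derivatives *)

Section weak_derivatives.
Context {R : realType} {n : nat}.
Implicit Types (x y v : 'rV[R]_n) (U K V : set 'rV[R]_n) (f g h phi w : 'rV[R]_n -> R).
Implicit Types (Y : 'rV[R]_n -> 'rV[R]_n).
Local Notation mu := (lebesgue_rV n).

Lemma Rintegral_sum (D : set 'rV[R]_n) (I : Type) (s : seq I) (F : I -> 'rV[R]_n -> R) :
  measurable D -> (forall i, mu.-integrable D (EFin \o F i)) ->
  mu.-integrable D (EFin \o (fun x => \sum_(i <- s) F i x)) /\
  \int[mu]_(x in D) (\sum_(i <- s) F i x) = \sum_(i <- s) \int[mu]_(x in D) F i x.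
Proof.
move=> mD iF; elim: s => [|i s [IH1 IH2]].
  have -> : (fun x => \sum_(i <- [::]) F i x) = fun=> 0.
    by apply/funext => x; rewrite big_nil.
  split; first exact: integrable0.
  by rewrite big_nil Rintegral_cst// mul0r.
have -> : (fun x => \sum_(i <- i :: s) F i x) = (fun x => F i x + \sum_(j <- s) F j x).
  by apply/funext => x; rewrite big_cons.
split; last by rewrite RintegralD// IH2 big_cons.
exact: (integrableD mD (iF i) IH1).
Qed.

(** No integrability is assumed: negation exchanges positive and negative parts, and [fine] sends
    every infinite value to 0. *)
Lemma RintegralN (D : set 'rV[R]_n) f :
  \int[mu]_(x in D) (- f x) = - \int[mu]_(x in D) f x.
Proof.
rewrite /Rintegral integralE [in RHS]integralE.
rewrite (_ : (fun x => (- f x)%:E) = (\- (EFin \o f))%E)//.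
rewrite funeposN funenegN.
by case: integral => [a||]; case: integral => [b||] //=; rewrite ?oppr0// opprB.
Qed.

Lemma test_mul_integrable U g phi : open U -> loc_integrable U g ->
  test_function U phi -> mu.-integrable U (EFin \o (fun x => g x * phi x)).
Proof.
move=> oU ig /test_functionW[phiC [K [cK KU] phi0]].
have mK := compact_measurable_rV cK.
apply: (integrable_support mK (open_measurable_rV oU) KU).
  by move=> x /phi0 ->; rewrite mulr0.
have cphi x : {for x, continuous phi} by exact: Ck1_continuous (phiC setT) I.
have [C C0 phib] := continuous_compact_bounded cK (fun x _ => cphi x).
rewrite (_ : _ \o _ = ((EFin \o phi) \* (EFin \o g))%E); last first.
  by apply/funext => x /=; rewrite mulrC EFinM.
apply: integrableMr => //.
- exact: (measurable_funS measurableT (@subsetT _ _) (continuous_measurable_rV openT (fun x _ => cphi x))).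
- exists C; split; first exact: num_real.
  by move=> M CM x /= Kx; apply: le_trans (phib x Kx) (ltW CM).
- exact: ig.
Qed.

Lemma weak_vderiv_unique Y U w g h : open U ->
  is_weak_vderiv Y U w g -> is_weak_vderiv Y U w h ->
  {ae mu, forall x, U x -> g x = h x}.
Proof.
move=> oU [_ ig wg] [_ ih wh].
have igh : loc_integrable U (fun x => g x - h x).
  move=> K cK KU.
  rewrite (_ : _ \o _ = ((EFin \o g) \- (EFin \o h))%E)//.
  by apply: integrableB; [exact: compact_measurable_rV|exact: ig|exact: ih].
have H := fundamental_lemma oU igh.
apply: filterS (H _) => [x gh Ux|phi tphi]; first by apply/eqP; rewrite -subr_eq0 gh.
under eq_Rintegral do rewrite mulrBl.
rewrite RintegralB; first by rewrite wg// wh// subrr.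
- exact: open_measurable_rV.
- exact: test_mul_integrable.
- exact: test_mul_integrable.
Qed.

Lemma loc_integrable_continuous U f : open U ->
  (forall x, U x -> {for x, continuous f}) -> loc_integrable U f.
Proof. by move=> oU cf K cK KU; exact: (continuous_compact_integrable oU). Qed.

Lemma divergence_scale phi Y x :
  divergence (fun y => phi y *: Y y) x =
  \sum_(j < n) 'D_(delta_mx ord0 j) (fun y => phi y * Y y ord0 j) x.
Proof.
apply: eq_bigr => j _; congr ('D_ _ _ x); apply/funext => y.
by rewrite mxE.
Qed.

Lemma divergence_support K phi Y : closed K -> (forall x, ~ K x -> phi x = 0) ->
  forall x, ~ K x -> divergence (fun y => phi y *: Y y) x = 0.
Proof.
move=> cK phi0 x Kx; rewrite divergence_scale big1// => j _.
by apply: (@derive_support _ _ K (fun y => phi y * Y y ord0 j)) => // y /phi0 ->; rewrite mul0r.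
Qed.

(** The divergence of phi w Y has compact support and integral 0; the product rule splits it into
    the two sides of the weak formulation. *)
Lemma classical_weak_vderiv U Y w : open U -> (forall j, Ck 1 U (fun y => Y y ord0 j)) ->
  Ck 1 U w -> is_weak_vderiv Y U w (vderiv Y w).
Proof.
move=> oU YC wC; split.
- by apply: loc_integrable_continuous => // x; exact: Ck1_continuous.
- by apply: loc_integrable_continuous => // x; exact: vderiv_continuous.
move=> phi /test_functionW[phiC [K [cK KU] phi0]].
have clK := compact_closed (@norm_hausdorff _ _) cK.
have mU := open_measurable_rV oU.
have mK := compact_measurable_rV cK.
have [dw cw] := wC; have [dphi cphi] := phiC U.
pose e j : 'rV[R]_n := delta_mx ord0 j.
have FC j := C1_supp_test_mul oU phiC cK KU phi0 (Ck1M oU wC (YC j)).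
pose F j x := phi x * (w x * Y x ord0 j).
have iF j : mu.-integrable U (EFin \o 'D_(e j) (F j)).
  have [_ _ cD [_ F0]] := FC j.
  apply: (integrable_support mK mU KU).
    exact: derive_support clK F0.
  exact: (continuous_compact_integrable openT (fun x _ => cD _ x) cK (@subsetT _ _)).
have sum0 : \int[mu]_(x in U) (\sum_(j < n) 'D_(e j) (F j) x) = 0.
  have [_ ->] := Rintegral_sum (index_enum 'I_n) mU iF.
  apply: big1 => j _; have [_ _ _ [_ F0]] := FC j.
  rewrite (Rintegral_support KU (derive_support (e j) clK F0)).
  exact: Rintegral_derive0 (FC j).
have dYphi j x : U x -> differentiable (fun y => phi y * Y y ord0 j) x.
  by move=> Ux; have [dY _] := YC j; apply: differentiableM; [exact: dphi|exact: dY].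
have E x : U x -> \sum_(j < n) 'D_(e j) (F j) x =
    vderiv Y w x * phi x + w x * divergence (fun y => phi y *: Y y) x.
  move=> Ux; rewrite (vderivE _ wC Ux) divergence_scale mulr_suml mulr_sumr -big_split/=.
  apply: eq_bigr => j _.
  rewrite (_ : F j = fun y => w y * (phi y * Y y ord0 j)); last first.
    by apply/funext => y; rewrite /F mulrCA.
  rewrite deriveM; last 2 first.
    by apply: diff_derivable; exact: dw.
    by apply: diff_derivable; exact: dYphi.
  by rewrite /GRing.scale/= -/(e j); ring.
have cdiv x : U x -> {for x, continuous (divergence (fun y => phi y *: Y y))}.
  move=> Ux; rewrite (_ : divergence _ = fun x => \sum_(j < n) 'D_(e j) (fun y => phi y * Y y ord0 j) x).
    apply: continuous_at_sum => j.
    by have [_ c] := Ck1M oU (phiC U) (YC j); exact: c (e j) x Ux.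
  by apply/funext => y; exact: divergence_scale.
have i1 : mu.-integrable U (EFin \o (fun x => vderiv Y w x * phi x)).
  apply: (integrable_support mK mU KU).
    by move=> x /phi0 ->; rewrite mulr0.
  apply: (continuous_compact_integrable oU) => // x Ux.
  exact: cvgM (vderiv_continuous oU YC wC Ux) (Ck1_continuous (phiC U) Ux).
have i2 : mu.-integrable U (EFin \o (fun x => w x * divergence (fun y => phi y *: Y y) x)).
  apply: (integrable_support mK mU KU).
    by move=> x Kx; rewrite (divergence_support Y clK phi0 Kx) mulr0.
  apply: (continuous_compact_integrable oU) => // x Ux.
  exact: cvgM (Ck1_continuous wC Ux) (cdiv x Ux).
apply/eqP; rewrite -subr_eq0 opprK -RintegralD// -[X in _ == X]sum0; apply/eqP.
by apply: eq_Rintegral => x /set_mem/E ->.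
Qed.

(** A test function on U is one on V, and all integrals reduce to its support. *)
Lemma is_weak_vderiv_restrict V U Y w g : open U -> U `<=` V ->
  is_weak_vderiv Y V w g -> is_weak_vderiv Y U w g.
Proof.
move=> oU UV [iw ig wg].
split.
- by move=> K cK KU; apply: iw => //; exact: subset_trans UV.
- by move=> K cK KU; apply: ig => //; exact: subset_trans UV.
move=> phi [phiC [K [cK KU] phi0]].
have clK := compact_closed (@norm_hausdorff _ _) cK.
have KV := subset_trans KU UV.
have tV : test_function V phi by split=> //; exists K.
have h1 x : ~ K x -> g x * phi x = 0 by move=> /phi0 ->; rewrite mulr0.
have h2 x : ~ K x -> w x * divergence (fun y => phi y *: Y y) x = 0.
  by move=> Kx; rewrite (divergence_support Y clK phi0 Kx) mulr0.
rewrite (Rintegral_support KU h1) (Rintegral_support KU h2).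
rewrite -(Rintegral_support KV h1) -(Rintegral_support KV h2).
exact: wg.
Qed.

Lemma is_weak_vderivN U Y w g : open U -> is_weak_vderiv Y U w g ->
  is_weak_vderiv Y U (fun x => - w x) (fun x => - g x).
Proof.
move=> oU [iw ig wg].
have locN f : loc_integrable U f -> loc_integrable U (fun x => - f x).
  move=> jf K cK KU; rewrite (_ : _ \o _ = (-%E \o (EFin \o f))%E)//.
  by apply: integrableN; exact: jf.
split; [exact: locN|exact: locN|move=> phi tphi].
under eq_Rintegral do rewrite mulNr.
under [in RHS]eq_Rintegral do rewrite mulNr.
by rewrite !RintegralN wg.
Qed.

End weak_derivatives.

(** * Minimality against C^1 competitors *)

Section minimizers.
Context {R : realType} {n m : nat}.
Implicit Types (X : 'I_m -> 'rV[R]_n -> 'rV[R]_n) (U Omega : set 'rV[R]_n).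
Implicit Types (u w f : 'rV[R]_n -> R).
Local Notation mu := (lebesgue_rV n).

Lemma ess_sup_on_le U f (M : R) : 0 <= M -> {ae mu, forall x, U x -> f x <= M} ->
  (ess_sup_on U f <= M%:E)%E.
Proof.
move=> M0 fM; apply/ess_supP; apply: filterS fM => x fM.
rewrite patchE; case: ifPn => [/set_mem Ux|_]; last by rewrite lee_fin.
by rewrite lee_fin fM.
Qed.

Lemma ae_le_ess_sup_on U f (M : R) : (ess_sup_on U f <= M%:E)%E ->
  {ae mu, forall x, U x -> f x <= M}.
Proof.
move=> /ess_supP; apply: filterS => x h Ux.
by move: h; rewrite patchE mem_set//= lee_fin.
Qed.

(** The part of minimality that the touching argument consumes. It asks for some weak gradient
    instead of the chosen [hgrad], so that it passes from u to - u at once. *)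
Definition C1_minimizer X Omega u : Prop :=
  forall U w (M C : R), open U -> U `<=` Omega -> Ck 1 U w ->
  (forall x, U x -> `|w x| <= C) -> eq_on_boundary U w u -> 0 <= M ->
  (forall x, U x -> \sum_(i < m) vderiv (X i) w x ^+ 2 <= M) ->
  exists g, is_hgrad X U u g /\
    {ae mu, forall x, U x -> \sum_(i < m) g x ord0 i ^+ 2 <= M}.

Lemma classical_hgrad X U w : open U -> (forall i, Ck 1 U (X i)) -> Ck 1 U w ->
  is_hgrad X U w (fun x => \row_i vderiv (X i) w x).
Proof.
move=> oU XC wC i.
rewrite (_ : (fun x => _) = vderiv (X i) w); last by apply/funext => x; rewrite mxE.
exact: (classical_weak_vderiv oU (fun j => Ck1_row_coord j oU (XC i)) wC).
Qed.

Lemma hgradP X U w g : is_hgrad X U w g -> is_hgrad X U w (hgrad X U w).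
Proof. by move=> wg; rewrite /hgrad; apply: (@xgetPex _ _ [set g | is_hgrad X U w g]); exists g. Qed.

(** [hgrad] is an arbitrary choice; uniqueness of weak derivatives pins it down almost
    everywhere. *)
Lemma hgrad_classical X U w : open U -> (forall i, Ck 1 U (X i)) -> Ck 1 U w ->
  {ae mu, forall x, U x -> forall i, hgrad X U w x ord0 i = vderiv (X i) w x}.
Proof.
move=> oU XC wC; have wg := classical_hgrad oU XC wC; have wh := hgradP wg.
have H i := weak_vderiv_unique oU (wh i) (wg i).
have : {ae mu, forall x, forall i, U x -> hgrad X U w x ord0 i = (\row_i vderiv (X i) w x) ord0 i}.
  exact: filter_forall.
by apply: filterS => x h Ux i; rewrite h// mxE.
Qed.

Lemma AMLE_C1_minimizer X Omega u : (forall i, Ck 1 Omega (X i)) ->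
  AMLE X Omega u -> C1_minimizer X Omega u.
Proof.
move=> XC [[cu [gu ugu] _] umin] U w M C oU UO wC wb wu M0 wM.
have XCU i : Ck 1 U (X i) := Ck1_sub UO (XC i).
have hw := hgrad_classical oU XCU wC.
have Fw : (F_energy X w U <= M%:E)%E.
  apply: ess_sup_on_le => //; apply: filterS hw => x hx Ux.
  by under eq_bigr do rewrite hx//; exact: wM.
have ww : W1oo_cc X U w.
  split.
  - by move=> x; exact: Ck1_continuous.
  - by exists (fun x => \row_i vderiv (X i) w x); exact: classical_hgrad.
  (* The bound C may be negative when U is empty, hence [|C|]. A component p of the gradient
     satisfies |p| <= 1 + p^2 <= 1 + M. *)
  - apply: (@le_lt_trans _ _ (`|C|%:E + (1 + M)%:E)%E); last by rewrite -EFinD ltry.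
    apply: leeD; apply: ess_sup_on_le => //.
    + apply: aeW => x Ux; exact: le_trans (wb x Ux) (ler_norm C).
    + by rewrite addr_ge0.
    + apply: filterS hw => x hx Ux; apply: norm_rV_le; first by rewrite addr_ge0.
      move=> i; rewrite hx//; have := wM x Ux.
      rewrite (bigD1 i)//= => wMi.
      have : vderiv (X i) w x ^+ 2 <= M.
        apply: le_trans wMi; rewrite lerDl; apply: sumr_ge0 => j _; exact: sqr_ge0.
      by rewrite -real_normK ?num_real//; nra.
have ugU : is_hgrad X U u gu by move=> i; exact: is_weak_vderiv_restrict oU UO (ugu i).
exists (hgrad X U u); split; first exact: hgradP ugU.
apply: ae_le_ess_sup_on; apply: le_trans Fw; exact: umin.
Qed.

Lemma C1_minimizerN X Omega u : C1_minimizer X Omega u ->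
  C1_minimizer X Omega (fun x => - u x).
Proof.
move=> umin U w M C oU UO wC wb wu M0 wM.
have NC : Ck 1 U (fun x => -1 * w x) by exact: (Ck1M oU (Ck1_cst U (-1)) wC).
have H1 x : U x -> `|-1 * w x| <= C.
  by move=> Ux; rewrite mulN1r normrN; exact: wb.
have H2 : eq_on_boundary U (fun x => -1 * w x) u.
  move=> y Uy; have := wu y Uy => H.
  have {}H := cvgN H; rewrite oppr0 in H.
  rewrite (_ : (fun x => _) = (fun x => - (w x - - u x))); first exact: H.
  by apply/funext => x; ring.
have H3 x : U x -> \sum_(i < m) vderiv (X i) (fun x => -1 * w x) x ^+ 2 <= M.
  move=> Ux; apply: le_trans (wM x Ux); apply: ler_sum => i _.
  have [dw _] := wC.
  rewrite /vderiv deriveM; [|exact: derivable_cst|exact: diff_derivable (dw x Ux)].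
  by rewrite (derive_cst (-1 : R)) scaler0 addr0 /GRing.scale/= mulN1r sqrrN.
have [g [ug gM]] := umin U (fun x => -1 * w x) M C oU UO NC H1 H2 M0 H3.
exists (fun x => - g x); split.
  move=> i; have := is_weak_vderivN oU (ug i).
  by congr (is_weak_vderiv _ _ _ _); apply/funext => x; rewrite mxE.
apply: filterS gM => x gx Ux; apply: le_trans (gx Ux); apply: ler_sum => i _.
by rewrite mxE sqrrN.
Qed.

End minimizers.

(** * Mollification *)

Section mollifier.
Context {R : realType} {n : nat}.
Implicit Types (x y z d v : 'rV[R]_n) (U K : set 'rV[R]_n) (u : 'rV[R]_n -> R) (r : R).
Local Notation mu := (lebesgue_rV n).

(** The second point z need not lie in K. *)
Lemma compact_uniform_continuity K u (e : R) : compact K ->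
  (forall x, K x -> {for x, continuous u}) -> 0 < e ->
  exists2 r : R, 0 < r & forall x z, K x -> `|z - x| <= r -> `|u z - u x| <= e.
Proof.
move=> /compact_near_coveringP cK cu e0.
have : \forall r \near (0:R)^'+, K `<=` [set x | forall z, `|z - x| <= r -> `|u z - u x| <= e].
  apply: cK => x Kx.
  have /cvgrPdist_lt/(_ (e / 2)) := cu x Kx; rewrite divr_gt0// => /(_ isT).
  move=> /nbhs_ballP[r /= r0 ur].
  exists (ball x (r / 2), [set t | t < r / 2]) => /=.
    split; first by apply: nbhsx_ballx; rewrite divr_gt0.
    by apply: nbhs_right_lt; rewrite divr_gt0.
  move=> [x' t] /= [xx' tr] z zt.
  have /ur H1 : ball x r x'.
    by apply: le_ball xx'; rewrite ler_pdivrMr// ler_peMr ?ler1n// ltW.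
  have /ur H2 : ball x r z.
    move: xx'; rewrite -!ball_normE /= => xx'.
    rewrite -(subrKA x') (splitr r); apply: (le_lt_trans (ler_normD _ _)).
    by apply: ltrD => //; rewrite distrC; apply: le_lt_trans tr.
  rewrite -(subrKA (u x)) (splitr e) (le_trans (ler_normD _ _))// lerD//.
    by rewrite distrC ltW.
  exact: ltW.
move=> H; have [r [Kr r0]] := filter_ex (filterI H (nbhs_right_gt (0:R))).
by exists r => // x z Kx; exact: Kr.
Qed.

(** Not normalised: the total mass is carried along as a factor in the estimates. *)
Definition mollifier r : 'rV[R]_n -> R := bump r^-1 (- const_mx r) (const_mx r).

Lemma flat_alg_mollifier r : flat_alg (mollifier r).
Proof. exact: flat_alg_bump. Qed.

Lemma mollifier_shift r z x : mollifier r (z - x) =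
  bump r^-1 (x - const_mx r) (x + const_mx r) z.
Proof.
by apply: eq_bigr => j _; rewrite !mxE; congr (flat _ _ * flat _ _); ring.
Qed.

Lemma mollifier_scale r d : 0 < r -> mollifier r d = mollifier 1 (r^-1 *: d).
Proof.
move=> r0; have rn0 : r != 0 by rewrite gt_eqF.
by apply: eq_bigr => j _; rewrite !mxE; congr (flat _ _ * flat _ _); field.
Qed.

Lemma mollifier_ge0 r d : 0 <= mollifier r d. Proof. exact: bump_ge0. Qed.

Lemma mollifier_out r d : 0 < r -> r <= `|d| -> mollifier r d = 0.
Proof.
move=> r0 rd; apply: bump_out; first by rewrite invr_ge0 ltW.
move=> H; move: rd; rewrite leNgt => /negP; apply; apply: norm_rV_lt => // j.
by have := H j; rewrite /= in_itv/= !mxE ltr_norml.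
Qed.

(** The mollifiers are rescalings of the one with r = 1, so the chain rule yields the factor 1/r
    with a constant independent of r. *)
Lemma derive_mollifier_bound : exists2 C : R, 0 <= C & forall r, 0 < r ->
  forall (j : 'I_n) d, `|'D_(delta_mx ord0 j) (mollifier r) d| <= C / r.
Proof.
pose e j : 'rV[R]_n := delta_mx ord0 j.
have [dH DH] := flat_alg_derive (flat_alg_mollifier 1).
have cH v : continuous ('D_v (mollifier 1)).
  move=> x; have [dD _] := flat_alg_derive (DH v).
  exact: differentiable_continuous (dD x).
have cK := @compact_closed_ball_rV R n 0 1.
have out d : ~ closed_ball_ normr (0 : 'rV[R]_n) 1 d -> mollifier 1 d = 0.
  move=> nd; apply: mollifier_out => //; rewrite leNgt; apply/negP => d1.
  by apply: nd; rewrite /closed_ball_/= sub0r normrN ltW.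
have clK := compact_closed (@norm_hausdorff _ _) cK.
have bd j : exists C : R, 0 <= C /\ forall d, `|'D_(e j) (mollifier 1) d| <= C.
  have [C C0 Cb] := compactly_supported_bounded (cH (e j)) cK
    (derive_support (e j) clK out).
  by exists C.
have [c cP] := choice bd.
exists (\sum_j c j) => [|r r0 j d]; first by apply: sumr_ge0 => j _; have [] := cP j.
have -> : 'D_(e j) (mollifier r) d = r^-1 * 'D_(e j) (mollifier 1) (r^-1 *: d).
  have [dr _] := flat_alg_derive (flat_alg_mollifier r).
  have [_] := @line_derive _ _ (mollifier r) d (e j) 0 (diff_derivable (dr _)).
  rewrite scale0r addr0 => <-.
  have -> : (fun s : R => mollifier r (d + s *: e j)) =
      (fun s : R => mollifier 1 (r^-1 *: d + s *: e j)) \o (fun s => r^-1 * s).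
    by apply/funext => s /=; rewrite mollifier_scale// scalerDr scalerA.
  have d1 : is_derive (0:R) (1:R) (fun s : R => r^-1 * s) r^-1.
    have H := is_deriveZ r^-1 (is_derive_id (0:R) (1:R)).
    by apply: (is_derive_eq H); rewrite /GRing.scale/= mulr1.
  have H := @line_derive _ _ (mollifier 1) (r^-1 *: d) (e j) (r^-1 * 0) (diff_derivable (dH _)).
  have [_ ->] := @is_derive1_comp _ _ (fun s => r^-1 * s) 0 _ _ H d1.
  by rewrite mulr0 scale0r addr0 mulrC.
have ri0 : 0 <= r^-1 by rewrite invr_ge0 ltW.
rewrite normrM (ger0_norm ri0) [leLHS]mulrC ler_wpM2r//.
have [_ /(_ (r^-1 *: d)) H] := cP j; apply: (le_trans H).
by rewrite (bigD1 j)//= lerDl; apply: sumr_ge0 => k _; have [] := cP k.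
Qed.

(** On the half ball each of the 2n factors has an argument of at least 1/2. *)
Lemma mollifier_half_ge r d : 0 < r -> `|d| <= r / 2 ->
  flat (1 : {poly R}) 2^-1 ^+ (2 * n) <= mollifier r d.
Proof.
move=> r0 dr; rewrite exprM -[n in X in X <= _]card_ord -prodr_const.
apply: ler_prod => j _; rewrite sqr_ge0 !mxE/= expr2.
have jd : `|d ord0 j| <= r / 2 by apply: le_trans (coord_norm_le d j) dr.
move: jd; rewrite ler_norml => /andP[H1 H2].
by apply: ler_pM; rewrite ?flat1_ge0//; apply: flat1_homo;
  rewrite -ler_pdivrMl ?invr_gt0// invrK; lra.
Qed.

Lemma lebesgue_closed_ball x r : 0 < r ->
  lebesgue_rV n (closed_ball_ normr x r) = ((2 * r) ^+ n)%:E.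
Proof.
move=> r0.
have -> : closed_ball_ normr x r =
  [set y | forall j, `[x ord0 j - r, x ord0 j + r]%classic (y ord0 j)].
  apply/seteqP; split=> y /=.
    move=> xy j; rewrite in_itv/= -ler_distlC.
    by have := coord_norm_le (x - y) j; rewrite !mxE => /le_trans; apply.
  move=> H; apply: norm_rV_le; first exact: ltW.
  by move=> j; have := H j; rewrite in_itv/= -ler_distlC !mxE.
rewrite (@lebesgue_rV_box R n (fun j => `[x ord0 j - r, x ord0 j + r]%classic))//.
rewrite (eq_bigr (fun=> (2 * r)%:E)).
  by rewrite prodEFin prodr_const card_ord.
move=> j _; rewrite lebesgue_measure_itv/= lte_fin ltrD2l.
by rewrite gtrN// -EFinB; congr EFin; ring.
Qed.

End mollifier.

(** * Unnormalised convolution of a continuous function with the mollifier *)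

Section mollification.
Context {R : realType} {n : nat}.
Implicit Types (x y z d v : 'rV[R]_n) (U K : set 'rV[R]_n) (u f g : 'rV[R]_n -> R) (r : R).
Local Notation mu := (lebesgue_rV n).

Lemma derive_translate f x v z : 'D_v (fun z => f (z - x)) z = 'D_v f (z - x).
Proof.
have E : (fun h : R => h^-1 *: (f (h *: v + z - x) - f (z - x))) =
  (fun h : R => h^-1 *: (f (h *: v + (z - x)) - f (z - x))).
  by apply/funext => h; rewrite addrA.
by rewrite /derive /= E.
Qed.

Lemma derive_oppv f x v : differentiable f x -> 'D_(- v) f x = - 'D_v f x.
Proof. by move=> df; rewrite !deriveE// linearN. Qed.

Let mol_diff r x : differentiable (@mollifier R n r) x.
Proof. by have [d _] := flat_alg_derive (@flat_alg_mollifier R n r). Qed.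

Let mol_cont r v : continuous ('D_v (@mollifier R n r)).
Proof.
move=> x; have [_ D] := flat_alg_derive (@flat_alg_mollifier R n r).
by have [d _] := flat_alg_derive (D v); exact: differentiable_continuous.
Qed.

Let translate_cont f x : continuous f -> continuous (fun z => f (z - x)).
Proof.
move=> cf z; apply: (@continuous_comp _ _ _ (fun z => z - x) f); last exact: cf.
by apply: continuousD; [exact: cvg_id|exact: cst_continuous].
Qed.

Let mol_cont0 r : continuous (@mollifier R n r).
Proof. by move=> x; exact: differentiable_continuous. Qed.

Lemma mollifier_supp r x z : 0 < r -> ~ closed_ball_ normr x r z -> mollifier r (z - x) = 0.
Proof.
move=> r0 nz; apply: mollifier_out => //; rewrite leNgt; apply/negP => h.
by apply: nz; rewrite /closed_ball_/= distrC ltW.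
Qed.

Let dmol_out r x v z : 0 < r -> ~ closed_ball_ normr x r z ->
  'D_v (mollifier r) (z - x) = 0.
Proof.
move=> r0 nz; rewrite -derive_translate.
apply: (@derive_support _ _ (closed_ball_ normr x r)) => //.
  exact: closed_closed_ball_.
by move=> t; exact: mollifier_supp.
Qed.

Lemma mollifier_lipschitz r (C : R) d v : 0 < r ->
  (forall (j : 'I_n) d, `|'D_(delta_mx ord0 j) (@mollifier R n r) d| <= C / r) ->
  `|mollifier r (d + v) - mollifier r d| <= n%:R * (C / r) * `|v|.
Proof.
move=> r0 Cb; apply: segment_mean_value => t _; first exact: mol_diff.
rewrite (derive_linear (mol_diff _ _)); apply: (le_trans (ler_norm_sum _ _ _)).
apply: (@le_trans _ _ (\sum_(j < n) C / r * `|v|)).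
  by apply: ler_sum => j _; rewrite normrM mulrC ler_pM// coord_norm_le.
by rewrite sumr_const card_ord -[n%:R * _ * _]mulrA mulr_natl lexx.
Qed.

Definition mollifier_mass r : R := \int[mu]_z mollifier r z.

Lemma mollifier_massE x r : 0 < r -> \int[mu]_z mollifier r (z - x) = mollifier_mass r.
Proof.
move=> r0; apply: Rintegral_shift.
  exact: (continuous_measurable_rV openT (fun x _ => @mol_cont0 r x)).
apply: (@continuous_supp_integrable _ _ (closed_ball_ normr x r)).
- exact: translate_cont.
- exact: compact_closed_ball_rV.
- by move=> z; exact: mollifier_supp.
Qed.

(** Commutator errors arise as multiples of r^n; this bound turns them into multiples of the mass.
    The ball of radius r/2 is a cube of side r. *)
Lemma mollifier_mass_ge r : 0 < r ->
  flat (1 : {poly R}) 2^-1 ^+ (2 * n) * r ^+ n <= mollifier_mass r.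
Proof.
move=> r0; set h := flat _ _ ^+ _.
pose B := closed_ball_ normr (0 : 'rV[R]_n) (r / 2).
have cB : compact B by exact: compact_closed_ball_rV.
have mB := compact_measurable_rV cB.
have -> : h * r ^+ n = \int[mu]_(z in B) h.
  have vB := lebesgue_closed_ball (0 : 'rV[R]_n) (divr_gt0 r0 (ltr0n R 2)).
  have {}vB : fine (mu B) = r ^+ n by rewrite vB /= mulrCA divff ?mulr1// pnatr_eq0.
  by rewrite Rintegral_cst//; congr (h * _); exact/esym/vB.
have ih : mu.-integrable B (EFin \o (fun=> h)).
  apply: (bounded_compact_integrable (C := `|h|)) => //.
rewrite Rintegral_mkcond; apply: le_Rintegral => //.
- have := (integrable_mkcond (EFin \o (fun=> h)) mB).1 ih.
  by rewrite restrict_EFin.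
- apply: (@continuous_supp_integrable _ _ (closed_ball_ normr 0 r)).
  + exact: mol_cont0.
  + exact: compact_closed_ball_rV.
  + by move=> z nz; rewrite -(subr0 z); exact: mollifier_supp.
- move=> z _; rewrite patchE; case: ifPn => [/set_mem Bz|_]; last exact: mollifier_ge0.
  by apply: mollifier_half_ge => //; move: Bz; rewrite /B /closed_ball_/= sub0r normrN.
Qed.

(** Integration is over a compact K because u is controlled only inside U; where the r-ball about x
    lies in K this is the full convolution. *)
Definition mollify K u r x : R := \int[mu]_(z in K) (u z * mollifier r (z - x)).

Section compact_domain.
Variables (U K : set 'rV[R]_n) (u : 'rV[R]_n -> R) (r : R).
Hypotheses (oU : open U) (cu : forall x, U x -> {for x, continuous u}).
Hypotheses (cK : compact K) (KU : K `<=` U) (r0 : 0 < r).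

Let mK : measurable K. Proof. exact: compact_measurable_rV. Qed.

Let iu f : continuous f -> mu.-integrable K (EFin \o (fun z => u z * f z)).
Proof.
move=> cf; apply: (continuous_compact_integrable oU _ cK KU) => x Ux.
exact: cvgM (cu Ux) (cf x).
Qed.

Lemma derive_mollify x v (t : R) :
  is_derive t (1 : R) (fun s : R => mollify K u r (x + s *: v))
    (- \int[mu]_(z in K) (u z * 'D_v (mollifier r) (z - (x + t *: v)))).
Proof.
have [Cu Cu0 ub] := continuous_compact_bounded cK (fun x Kx => cu (KU Kx)).
have [Cv Cv0 vb] : exists2 C : R, 0 <= C & forall d, `|'D_v (@mollifier R n r) d| <= C.
  have out z : ~ closed_ball_ normr (0 : 'rV[R]_n) r z -> 'D_v (mollifier r) z = 0.
    by move=> nz; rewrite -(subr0 z); exact: dmol_out.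
  exact: (compactly_supported_bounded (@mol_cont r v) (@compact_closed_ball_rV R n 0 r) out).
have tI : `](t - 1), (t + 1)[%classic t by rewrite /= in_itv/=; apply/andP; split; lra.
have ld (s : R) z : is_derive s (1 : R) (fun s : R => u z * mollifier r (z - (x + s *: v)))
    (- (u z * 'D_v (mollifier r) (z - (x + s *: v)))).
  have H0 := @line_derive _ _ (@mollifier R n r) (z - x) (- v) s (diff_derivable (mol_diff _ _)).
  have H := is_deriveZ (u z) H0.
  have E (s' : R) : z - x + s' *: - v = z - (x + s' *: v) by rewrite scalerN opprD addrA.
  rewrite E in H.
  have -> : (fun s : R => u z * mollifier r (z - (x + s *: v))) =
            u z \*: (fun s0 : R => mollifier r (z - x + s0 *: - v)).
    by apply/funext => s'; rewrite /= E.
  apply: (is_derive_eq H); rewrite derive_oppv; last exact: mol_diff.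
  by rewrite scalerN.
have iF s : `](t - 1), (t + 1)[%classic s ->
    mu.-integrable K (EFin \o (fun z => u z * mollifier r (z - (x + s *: v)))).
  by move=> _; apply: iu; exact: translate_cont.
have dF (s : R) z : `](t - 1), (t + 1)[%classic s -> K z ->
    derivable (fun s : R => u z * mollifier r (z - (x + s *: v))) s 1.
  by move=> _ _; have [] := ld s z.
have G0 : forall z : 'rV[R]_n, 0 <= cst (Cu * Cv) z by move=> z; rewrite /= mulr_ge0.
have iG : mu.-integrable K (EFin \o cst (Cu * Cv)).
  apply: (bounded_compact_integrable (C := Cu * Cv)) => //.
  by move=> z _; rewrite /= ger0_norm// mulr_ge0.
have Gb (s : R) z : `](t - 1), (t + 1)[%classic s -> K z ->
    `|partial1of2 (fun s z => u z * mollifier r (z - (x + s *: v))) s z| <= cst (Cu * Cv) z.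
  move=> _ Kz; rewrite partial1of2E; have [_ ->] := ld s z.
  by rewrite normrN normrM ler_pM// ub.
split.
  exact: (derivable_under_integral mK tI iF dF G0 iG Gb).
rewrite -derive1E (differentiation_under_integral mK tI iF dF G0 iG Gb).
rewrite -RintegralN; apply: eq_Rintegral => z _; rewrite partial1of2E.
by have [_ ->] := ld t z.
Qed.

(** The Lipschitz bound of the mollifier passes to the integral. Continuity provides the maximum
    point used later. *)
Lemma mollify_continuous : continuous (mollify K u r).
Proof.
have [Cu Cu0 ub] := continuous_compact_bounded cK (fun x Kx => cu (KU Kx)).
have [C C0 Cb] := @derive_mollifier_bound R n.
pose A := Cu * (n%:R * (C / r)) * fine (mu K).
have A0 : 0 <= A.
  by rewrite !mulr_ge0 ?ler0n ?invr_ge0 ?fine_ge0// ltW.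
have lip x x' : `|mollify K u r x - mollify K u r x'| <= A * `|x - x'|.
  rewrite /mollify -RintegralB//; [|by apply: iu; exact: translate_cont..].
  have ii : mu.-integrable K (EFin \o (fun z =>
      u z * mollifier r (z - x) - u z * mollifier r (z - x'))).
    apply: (continuous_compact_integrable oU _ cK KU) => z Uz.
    exact: cvgB (cvgM (cu Uz) (@translate_cont (mollifier r) x (@mol_cont0 r) z))
      (cvgM (cu Uz) (@translate_cont (mollifier r) x' (@mol_cont0 r) z)).
  apply: (le_trans (le_normr_Rintegral mK ii)).
  apply: (@le_trans _ _ (\int[mu]_(z in K) (Cu * (n%:R * (C / r) * `|x - x'|)))).
    apply: le_Rintegral => //.
    - exact: integrable_norm.
    - exact: (bounded_compact_integrable (C := `|Cu * (n%:R * (C / r) * `|x - x'|)|)).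
    - move=> z Kz; rewrite -mulrBr normrM ler_pM// ?ub//.
      have -> : z - x = z - x' + (x' - x) by rewrite addrA subrK.
      by rewrite (distrC x x'); exact: mollifier_lipschitz r0 (Cb r r0).
  rewrite Rintegral_cst// /A; move: (fine _) => q.
  by rewrite le_eqVlt; apply/orP; left; apply/eqP; ring.
move=> x.
apply: ((@cvgrPdist_le _ _ _ (nbhs x) _ (mollify K u r) _).2) => e e0.
have eA : 0 < e / (A + 1) by rewrite divr_gt0// ltr_wpDl.
apply: (@filterS _ (nbhs x) _ (ball x (e / (A + 1)))); last exact: nbhsx_ballx.
move=> x'; rewrite -ball_normE /= => /ltW xx'.
apply: (le_trans (lip x x')); apply: (@le_trans _ _ ((A + 1) * `|x - x'|)).
  by rewrite ler_wpM2r// lerDl.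
by rewrite -ler_pdivlMl ?ltr_wpDl// mulrC.
Qed.

End compact_domain.
End mollification.

(** * Friedrichs commutator estimate *)

Section commutator_estimate.
Context {R : realType} {n : nat}.
Implicit Types (x y z d v : 'rV[R]_n) (U K : set 'rV[R]_n) (u f g : 'rV[R]_n -> R) (r : R).
Implicit Types Y : 'rV[R]_n -> 'rV[R]_n.
Local Notation mu := (lebesgue_rV n).

Lemma test_function_mollifier U x r : 0 < r -> closed_ball_ normr x r `<=` U ->
  test_function U (fun z => mollifier r (z - x)).
Proof.
move=> r0 BU; rewrite (_ : (fun z => _) = bump r^-1 (x - const_mx r) (x + const_mx r)).
  apply: test_function_bump; first by rewrite invr_ge0 ltW.
  move=> z H; apply: BU; apply: norm_rV_le; first exact: ltW.
  by move=> j; have := H j; rewrite /= in_itv/= !mxE -ler_distlC.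
by apply/funext => z; exact: mollifier_shift.
Qed.

(** Freezing the coefficients of Y at x turns the weak derivative along Y, tested
    against a mollifier centred at x, into the derivative of the mollification;
    the error is controlled by the oscillation w of u and not by its size. *)
Lemma commutator_estimate U Y u g x r (C L w : R) : open U ->
  (forall j, Ck 1 U (fun z => Y z ord0 j)) ->
  (forall z, U z -> {for z, continuous u}) -> is_weak_vderiv Y U u g ->
  0 < r -> 0 <= L -> 0 <= w ->
  (forall (j : 'I_n) d, `|'D_(delta_mx ord0 j) (@mollifier R n r) d| <= C / r) ->
  closed_ball_ normr x r `<=` U ->
  (forall z, closed_ball_ normr x r z -> forall j,
    `|'D_(delta_mx ord0 j) (fun z => Y z ord0 j) z| <= L) ->
  (forall z, closed_ball_ normr x r z -> forall j,
    `|Y z ord0 j - Y x ord0 j| <= L * r) ->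
  (forall z, closed_ball_ normr x r z -> `|u z - u x| <= w) ->
  `|\int[mu]_(z in U) (g z * mollifier r (z - x)) +
    \int[mu]_(z in U) (u z * 'D_(Y x) (mollifier r) (z - x))| <=
  w * (n%:R * (L * (1 + C))) * (2 * r) ^+ n.
Proof.
move=> oU YC cu [_ ig ug] r0 L0 w0 Cb BU bL bY bw.
set B := closed_ball_ normr x r in BU bL bY bw *.
have cB : compact B by exact: compact_closed_ball_rV.
have clB : closed B by exact: closed_closed_ball_.
have mB := compact_measurable_rV cB.
have mU := open_measurable_rV oU.
pose phi z := mollifier r (z - x).
have tphi : test_function U phi by exact: test_function_mollifier.
have phi0 z : ~ B z -> phi z = 0 by exact: mollifier_supp.
have [phiC _] := test_functionW tphi.
have [dphi cphi] := phiC setT.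
have Dphi v z : 'D_v (mollifier r) (z - x) = 'D_v phi z by rewrite derive_translate.
pose e j : 'rV[R]_n := delta_mx ord0 j.
have YxC j : Ck 1 U (fun z => Y z ord0 j + (- Y x ord0 j)).
  exact: (Ck1D oU (YC j) (Ck1_cst U (- Y x ord0 j))).
pose F j z := phi z * (Y z ord0 j + (- Y x ord0 j)).
(* The divergence of phi (Y - Y(x)): what remains of div(phi Y) after freezing Y at x. *)
pose E z := \sum_(j < n) 'D_(e j) (F j) z.
have FC j : C1_supp B (F j) := C1_supp_test_mul oU phiC cB BU phi0 (YxC j).
have cE z : {for z, continuous E}.
  by apply: continuous_at_sum => j; have [_ _ cD _] := FC j; exact: cD.
have E0 z : ~ B z -> E z = 0.
  move=> nz; apply: big1 => j _; have [_ _ _ [_ F0]] := FC j.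
  exact: (derive_support (e j) clB F0).
have dY j z : U z -> differentiable (fun z => Y z ord0 j) z by move=> Uz; have [d _] := YC j; exact: d.
have DF j z : U z -> 'D_(e j) (F j) z =
    phi z * 'D_(e j) (fun z => Y z ord0 j) z + (Y z ord0 j - Y x ord0 j) * 'D_(e j) phi z.
  move=> Uz; have [dYx _] := YxC j.
  rewrite deriveM; [|exact: diff_derivable (dphi z I)|exact: diff_derivable (dYx z Uz)].
  rewrite /GRing.scale/=; congr (_ * _ + _).
  rewrite deriveD; [|exact: diff_derivable (dY j z Uz)|exact: derivable_cst].
  by rewrite (derive_cst (- Y x ord0 j)) addr0.
have divE z : U z -> divergence (fun z => phi z *: Y z) z = E z + 'D_(Y x) phi z.
  move=> Uz; rewrite divergence_scale (derive_linear (dphi z I)) -big_split/=.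
  apply: eq_bigr => j _; rewrite DF//.
  rewrite deriveM; [|exact: diff_derivable (dphi z I)|exact: diff_derivable (dY j z Uz)].
  by rewrite /GRing.scale/= -/(e j); ring.
have onB f : (forall z, U z -> {for z, continuous f}) -> (forall z, ~ B z -> f z = 0) ->
    mu.-integrable U (EFin \o f).
  move=> cf f0; apply: (integrable_support mB mU BU f0).
  exact: (continuous_compact_integrable oU cf cB BU).
have iuE : mu.-integrable U (EFin \o (fun z => u z * E z)).
  apply: onB => [z Uz|z nz]; last by rewrite E0 ?mulr0.
  exact: cvgM (cu z Uz) (cE z).
have iE : mu.-integrable U (EFin \o (fun z => u x * E z)).
  apply: onB => [z Uz|z nz]; last by rewrite E0 ?mulr0.
  exact: cvgM (cvg_cst (u x)) (cE z).
have Dphi0 z : ~ B z -> 'D_(Y x) phi z = 0 := derive_support (Y x) clB phi0 (x := z).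
have iuD : mu.-integrable U (EFin \o (fun z => u z * 'D_(Y x) phi z)).
  apply: onB => [z Uz|z nz]; last by rewrite Dphi0 ?mulr0.
  exact: cvgM (cu z Uz) (cphi (Y x) z I).
(* Since [E] has integral 0, u can be replaced by u - u(x) in front of it; only the oscillation of u
   survives. *)
have intE : \int[mu]_(z in U) (u x * E z) = 0.
  rewrite RintegralZl//; last first.
    by apply: onB => [z _|z nz]; [exact: cE|exact: E0].
  have iD j : mu.-integrable U (EFin \o 'D_(e j) (F j)).
    have [_ _ cD [_ F0]] := FC j.
    by apply: onB => [z _|]; [exact: cD|exact: (derive_support (e j) clB F0)].
  have [_ ->] := Rintegral_sum (index_enum 'I_n) mU iD.
  rewrite big1 ?mulr0// => j _; have [_ _ _ [_ F0]] := FC j.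
  rewrite (Rintegral_support BU (derive_support (e j) clB F0)).
  exact: Rintegral_derive0 (FC j).
have -> : \int[mu]_(z in U) (g z * mollifier r (z - x)) +
    \int[mu]_(z in U) (u z * 'D_(Y x) (mollifier r) (z - x)) =
    - \int[mu]_(z in U) ((u z - u x) * E z).
  rewrite [X in X + _](ug _ tphi).
  under [X in _ + X]eq_Rintegral do rewrite Dphi.
  have -> : \int[mu]_(z in U) (u z * divergence (fun z => phi z *: Y z) z) =
    \int[mu]_(z in U) (u z * E z) + \int[mu]_(z in U) (u z * 'D_(Y x) phi z).
    rewrite -RintegralD//; apply: eq_Rintegral => z /set_mem Uz.
    by rewrite divE// mulrDr.
  rewrite opprD subrK; congr (- _).
  under [RHS]eq_Rintegral do rewrite mulrBl.
  by rewrite RintegralB// intE subr0.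
rewrite normrN.
have h0 z : ~ B z -> (u z - u x) * E z = 0 by move=> nz; rewrite E0// mulr0.
have cuE z : U z -> {for z, continuous (fun z => (u z - u x) * E z)}.
  by move=> Uz; exact: cvgM (cvgB (cu z Uz) (cvg_cst (u x))) (cE z).
rewrite (Rintegral_support BU h0) -(Rintegral_support (@subset_refl _ B) h0).
have iB := continuous_compact_integrable oU cuE cB BU.
apply: (le_trans (le_normr_Rintegral mB iB)).
apply: (@le_trans _ _ (\int[mu]_(z in B) (w * (n%:R * (L * (1 + C)))))).
  apply: le_Rintegral => //.
  - exact: integrable_norm.
  - exact: (bounded_compact_integrable (C := `|w * (n%:R * (L * (1 + C)))|)).
  move=> z Bz; rewrite normrM ler_pM// ?bw//.
  apply: (le_trans (ler_norm_sum _ _ _)).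
  apply: (@le_trans _ _ (\sum_(j < n) (L * (1 + C)))); last first.
    by rewrite sumr_const card_ord mulr_natl.
  apply: ler_sum => j _; rewrite DF; last exact: BU.
  apply: (le_trans (ler_normD _ _)); rewrite mulrDr mulr1 lerD//.
    rewrite normrM -[leRHS]mul1r ler_pM//; last exact: bL.
    by rewrite ger0_norm ?mollifier_ge0// bump_le1.
  (* The increment of Y is of order r and offsets the 1/r from the derivative of the mollifier. *)
  have -> : L * C = L * r * (C / r) by field; rewrite gt_eqF.
  rewrite normrM ler_pM//; first exact: bY.
  by rewrite -Dphi.
have vB := lebesgue_closed_ball x r0.
have {}vB : fine (mu B) = (2 * r) ^+ n by rewrite vB.
by rewrite Rintegral_cst// -vB.
Qed.

End commutator_estimate.

(** * Gradient bounds in the viscosity sense *)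

Section viscosity_eikonal.
Context {R : realType} {n m : nat}.
Implicit Types (x y z d v : 'rV[R]_n) (U K : set 'rV[R]_n) (u f theta : 'rV[R]_n -> R) (r : R).
Implicit Types X : 'I_m -> 'rV[R]_n -> 'rV[R]_n.
Local Notation mu := (lebesgue_rV n).

Lemma ae_Rintegral_ge0 (D : set 'rV[R]_n) f : measurable D ->
  mu.-integrable D (EFin \o f) -> {ae mu, forall x, D x -> 0 <= f x} ->
  0 <= \int[mu]_(x in D) f x.
Proof.
move=> mD If f0; have mf := measurable_int _ If.
have -> : \int[mu]_(x in D) f x = \int[mu]_(x in D) `|f x|.
  rewrite /Rintegral; congr fine; apply: ae_eq_integral => //.
    by have := measurable_int _ (integrable_norm If).
  by apply: filterS f0 => x h Dx; rewrite /= ger0_norm// h.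
exact: Rintegral_ge0.
Qed.

Lemma derive_sum_sqr (I : Type) (s : seq I) (F : I -> 'rV[R]_n -> R) x v :
  (forall i, differentiable (F i) x) ->
  differentiable (fun z => \sum_(i <- s) F i z * F i z) x /\
  'D_v (fun z => \sum_(i <- s) F i z * F i z) x = \sum_(i <- s) 2 * F i x * 'D_v (F i) x.
Proof.
move=> dF; elim: s => [|i s [IH1 IH2]].
  rewrite (_ : (fun _ => _) = fun=> 0); last by apply/funext => z; rewrite big_nil.
  by rewrite big_nil (derive_cst (0 : R)); split => //; exact: differentiable_cst.
rewrite (_ : (fun _ => _) = fun z => F i z * F i z + \sum_(j <- s) F j z * F j z); last first.
  by apply/funext => z; rewrite big_cons.
have dFF : differentiable (fun z => F i z * F i z) x by exact: differentiableM.
split; first exact: differentiableD.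
rewrite deriveD; [|exact: diff_derivable|exact: diff_derivable].
rewrite deriveM; [|exact: diff_derivable|exact: diff_derivable].
by rewrite IH2 big_cons /GRing.scale/=; congr (_ + _); ring.
Qed.

Lemma closed_ball_near (P : 'rV[R]_n -> Prop) y : (\forall x \near y, P x) ->
  exists2 e : R, 0 < e & closed_ball_ normr y e `<=` P.
Proof.
move=> /nbhs_ballP[e /= e0 eP]; exists (e / 2); first by rewrite divr_gt0.
move=> x xy; apply: eP; rewrite -ball_normE /=; apply: le_lt_trans xy _.
by rewrite ltr_pdivrMr// ltr_pMr// ltr1n.
Qed.

Lemma closed_ball_trans x y z (r s t : R) : closed_ball_ normr y s x ->
  closed_ball_ normr x r z -> s + r <= t -> closed_ball_ normr y t z.
Proof.
rewrite /closed_ball_/= => yx xz srt; rewrite -(subrKA x).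
by apply: le_trans (ler_normD _ _) (le_trans (lerD yx xz) srt).
Qed.

Lemma eq0_derive_max (F : R -> R) (d D : R) : 0 < d ->
  (forall t : R, `|t| < d -> derivable F t 1) -> is_derive (0 : R) (1 : R) F D ->
  (forall t : R, `|t| < d -> F t <= F 0) -> D = 0.
Proof.
move=> d0 dF [_ FD] Fmax.
have itvE (t : R) : t \in `](- d), d[ = (`|t| < d) by rewrite in_itv/= ltr_norml.
have zI : (0 : R) \in `](- d), d[ by rewrite itvE normr0.
have [||||_ F0] := @derive1_at_max _ F (- d) d 0.
- by rewrite ge0_cp// ltW.
- by move=> t; rewrite itvE; exact: dF.
- by [].
- by move=> t; rewrite itvE; exact: Fmax.
by rewrite -FD F0.
Qed.

Lemma local_lipschitz_fields X U K : open U -> (forall i, Ck 1 U (X i)) ->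
  compact K -> K `<=` U -> exists2 L : R, 0 <= L & forall i (j : 'I_n) k z, K z ->
  `|'D_(delta_mx ord0 k) (fun z => X i z ord0 j) z| <= L.
Proof.
move=> oU XC cK KU.
have H (p : 'I_m * 'I_n * 'I_n) : exists C : R, 0 <= C /\ forall z, K z ->
    `|'D_(delta_mx ord0 p.2) (fun z => X p.1.1 z ord0 p.1.2) z| <= C.
  have [_ cD] := Ck1_row_coord p.1.2 oU (XC p.1.1).
  have [C C0 Cb] := continuous_compact_bounded cK (fun z Kz => cD (delta_mx ord0 p.2) z (KU z Kz)).
  by exists C.
have [c cP] := choice H.
exists (\sum_p c p) => [|i j k z Kz]; first by apply: sumr_ge0 => p _; have [] := cP p.
have [_ /(_ z Kz) /= h] := cP (i, j, k); apply: (le_trans h).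
by rewrite (bigD1 (i, j, k))//= lerDl; apply: sumr_ge0 => p _; have [] := cP p.
Qed.

Lemma mollify_osc U K u r x (w : R) : open U ->
  (forall x, U x -> {for x, continuous u}) -> compact K -> K `<=` U -> 0 < r ->
  closed_ball_ normr x r `<=` K ->
  (forall z, closed_ball_ normr x r z -> `|u z - u x| <= w) ->
  `|mollify K u r x - mollifier_mass (n := n) r * u x| <= w * mollifier_mass (n := n) r.
Proof.
move=> oU cu cK KU r0 BK osc; set mass := mollifier_mass r.
have mK := compact_measurable_rV cK.
pose phi z : R := mollifier r (z - x).
have cphi : continuous phi.
  move=> z; have [phiC _] := test_functionW (test_function_mollifier (x := x) r0 (@subsetT _ _)).
  exact: Ck1_continuous (phiC setT) I.
have B0 z : ~ closed_ball_ normr x r z -> phi z = 0 by exact: mollifier_supp.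
have massE : \int[mu]_(z in K) phi z = mass.
  by rewrite (Rintegral_support BK B0); exact: mollifier_massE.
have intK f : (forall z, U z -> {for z, continuous f}) -> mu.-integrable K (EFin \o f).
  by move=> cf; exact: (continuous_compact_integrable oU cf cK KU).
have im : mu.-integrable K (EFin \o phi) by apply: intK => z _; exact: cphi.
have ium : mu.-integrable K (EFin \o (fun z => u z * phi z)).
  by apply: intK => z Uz; exact: cvgM (cu z Uz) (cphi z).
have Il (a : R) : mu.-integrable K (EFin \o (fun z => a * phi z)).
  by apply: intK => z Uz; exact: cvgM (cvg_cst a) (cphi z).
have Zl (a : R) : \int[mu]_(z in K) (a * phi z) = a * mass.
  by rewrite (RintegralZl a mK im) massE.
have iB : mu.-integrable K (EFin \o (fun z => u z * phi z - u x * phi z)).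
  apply: intK => z Uz.
  exact: cvgB (cvgM (cu z Uz) (cphi z)) (cvgM (cvg_cst (u x)) (cphi z)).
have -> : mollify K u r x - mass * u x = \int[mu]_(z in K) (u z * phi z - u x * phi z).
  by rewrite (RintegralB mK ium (Il (u x))) Zl mulrC.
apply: (le_trans (le_normr_Rintegral mK iB)); rewrite -Zl.
apply: (le_Rintegral mK (integrable_norm iB) (Il w)) => z Kz.
have phi_ge0 : 0 <= phi z by exact: mollifier_ge0.
change (`|u z * phi z - u x * phi z| <= w * phi z).
rewrite -mulrBl normrM (ger0_norm phi_ge0).
have [Bz|nBz] := pselect (closed_ball_ normr x r z); last by rewrite B0// !mulr0.
exact: ler_wpM2r phi_ge0 _ _ (osc z Bz).
Qed.

Lemma mulr_le_half_sqr (a b : R) : a * b <= (a ^+ 2 + b ^+ 2) / 2.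
Proof. by have := sqr_ge0 (a - b); nra. Qed.

Lemma error_lower_bound (a b k e : R) : - (`|b| * (k * e)) <= b * (a - k * b) ->
  k * b ^+ 2 - k * (`|b| * e) <= b * a.
Proof. by move: `|b| => q; nra. Qed.

(** Here [Gy], [Gx] are mollified values and [qx] is the penalty. Maximality at x forces qx <= 2 w
    <= sq / 2, while the penalty is at least sq. *)
Lemma penalty_contradiction (mass w sq Gy Gx uy ux ty tx qx : R) :
  0 < mass -> 0 < sq -> w <= sq / 4 -> sq <= qx ->
  Gy - mass * ty <= Gx - mass * (tx + qx) ->
  - (w * mass) <= Gy - mass * uy -> Gx - mass * ux <= w * mass ->
  ux - tx <= uy - ty -> False.
Proof.
move=> m0 sq0 wsq sqq H1 H2 H3 H4.
have H5 : mass * (ux - tx) <= mass * (uy - ty) by rewrite ler_pM2l.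
have H6 : mass * sq <= mass * qx by rewrite ler_pM2l.
have H7 : w * mass <= sq / 4 * mass by rewrite ler_pM2r.
have H8 : 0 < mass * sq by rewrite mulr_gt0.
lra.
Qed.

(** Let c = X theta(y) and N = |c|^2. Near y the mollified u, minus a multiple of theta plus a
    penalty, has an interior maximum, where the average of g is close to c; so the average of c.g is
    close to N. But c.g <= (N + M) / 2 almost everywhere, which excludes N > M. *)
Lemma hgrad_bound_viscosity X U u g theta y (M : R) :
  open U -> (forall x, U x -> {for x, continuous u}) -> (forall i, Ck 1 U (X i)) ->
  is_hgrad X U u g ->
  {ae mu, forall x, U x -> \sum_(i < m) g x ord0 i ^+ 2 <= M} ->
  Ck 1 U theta -> U y -> (\forall x \near y, u x - theta x <= u y - theta y) ->
  \sum_(i < m) vderiv (X i) theta y ^+ 2 <= M.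
Proof.
move=> oU cu XC ug gM tC Uy ymax; rewrite leNgt; apply/negP => NM.
pose c i := vderiv (X i) theta y.
set N := \sum_(i < m) _ in NM.
pose kap := N - M; have kap0 : 0 < kap by rewrite subr_gt0.
(* The added 1 makes S a safe denominator. *)
pose S := \sum_(i < m) `|c i| + 1.
have S0 : 0 < S by rewrite ltr_wpDl// sumr_ge0.
(* the quadratic penalty makes the maximum strict without changing the gradient at y *)
pose l j x : R := x ord0 j + (- y ord0 j).
pose q x := \sum_(j < n) l j x * l j x.
have lC j : Ck 1 U (l j) := Ck1D oU (Ck1_coordinate U j) (Ck1_cst U (- y ord0 j)).
have qC : Ck 1 U q := Ck1_sum (index_enum 'I_n) oU (fun j => Ck1M oU (lC j) (lC j)).
have qy : q y = 0 by apply: big1 => j _; rewrite /l subrr mulr0.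
pose theta1 x := theta x + q x.
have t1C : Ck 1 U theta1 := Ck1D oU tC qC.
have c1 i : vderiv (X i) theta1 y = c i.
  have [dt _] := tC; have [dq _] := qC.
  rewrite /vderiv deriveD; [|exact: diff_derivable (dt y Uy)|exact: diff_derivable (dq y Uy)].
  have dl j : differentiable (l j) y by have [dl _] := lC j; exact: dl.
  have [_ ->] := derive_sum_sqr (index_enum 'I_n) (X i y) dl.
  by rewrite big1 ?addr0// => j _; rewrite {1}/l subrr mulr0 mul0r.
pose eta := kap / (8 * S).
have eta0 : 0 < eta by rewrite divr_gt0// mulr_gt0.
have near_c : \forall x \near y, forall i, `|vderiv (X i) theta1 x - c i| <= eta.
  suff H i : \forall x \near y, `|vderiv (X i) theta1 x - c i| <= eta.
    exact: (@filter_forall _ _ _ (nbhs y) _ H).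
  have cv := vderiv_continuous oU (fun j => Ck1_row_coord j oU (XC i)) t1C Uy.
  have /cvgrPdist_le/(_ eta eta0) := cv.
  by apply: filterS => x; rewrite c1 distrC.
have near_U : \forall x \near y, U x by exact: open_nbhs_nbhs.
have [s2 s20 Hs2] := closed_ball_near (filterI near_U (filterI near_c ymax)).
(* The maximum is sought in the ball of radius s; mollifying at a scale r <= s then uses only values
   from the ball of radius s2. *)
pose s := s2 / 2; have s0 : 0 < s by rewrite divr_gt0.
have ss2 : s + s = s2 by rewrite /s -splitr.
have ss : s <= s2 by rewrite -ss2 lerDl ltW.
pose K := closed_ball_ normr y s2.
have cK : compact K by exact: compact_closed_ball_rV.
have KU : K `<=` U by move=> x /Hs2[].
have mK := compact_measurable_rV cK.
have mU := open_measurable_rV oU.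
have [L1 L10 L1b] := local_lipschitz_fields oU XC cK KU.
(* Large enough both for the partial derivatives, bounded by L1, and for the increments over a
   distance r, bounded by n L1 r. *)
pose L := n.+1%:R * L1.
have L0 : 0 <= L by rewrite mulr_ge0.
have L1L : L1 <= L by rewrite ler_peMl// ler1n.
have [C C0 Cb] := @derive_mollifier_bound R n.
pose h0 : R := flat (1 : {poly R}) 2^-1 ^+ (2 * n).
have h00 : 0 < h0 by rewrite exprn_gt0// flat1_gt0// invr_gt0.
(* The commutator error is a multiple of (2 r)^n and the mass is at least h0 r^n; C' is the
   resulting ratio per unit of oscillation. *)
pose C' := n%:R * (L * (1 + C)) * 2 ^+ n / h0.
have C'0 : 0 <= C' by rewrite divr_ge0 ?(ltW h00)// !mulr_ge0 ?exprn_ge0// addr_ge0.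
(* Admissible oscillation, fixed before r: the first bound makes the commutator error small against
   kap, the second keeps the maximum off the sphere of radius s. *)
pose w := Num.min (kap / (8 * S * (C' + 1))) (s ^+ 2 / 4).
have w0 : 0 < w.
  by rewrite lt_min !divr_gt0 ?exprn_gt0// !mulr_gt0// ltr_wpDl.
have w1 : w <= kap / (8 * S * (C' + 1)) by rewrite ge_min lexx.
have w2 : w <= s ^+ 2 / 4 by rewrite ge_min lexx orbT.
have [r1 r10 uw] := compact_uniform_continuity cK (fun x Kx => cu x (KU x Kx)) w0.
pose r := Num.min r1 s.
have r0 : 0 < r by rewrite lt_min r10 s0.
have rr1 : r <= r1 by rewrite ge_min lexx.
have rs : r <= s by rewrite ge_min lexx orbT.
pose Ks := closed_ball_ normr y s.
have cKs : compact Ks by exact: compact_closed_ball_rV.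
have yKs : Ks y by rewrite /Ks /closed_ball_/= subrr normr0 ltW.
have KsK : Ks `<=` K by move=> x; rewrite /Ks /K /closed_ball_/= => /le_trans; apply.
have BK x : Ks x -> closed_ball_ normr x r `<=` K.
  by move=> Kx z xz; apply: closed_ball_trans Kx xz _; rewrite -ss2 lerD2l.
have osc x z : Ks x -> closed_ball_ normr x r z -> `|u z - u x| <= w.
  move=> Kx xz; apply: uw; first exact: KsK.
  by rewrite distrC; apply: le_trans rr1.
pose mass := mollifier_mass (n := n) r.
have massh := mollifier_mass_ge (n := n) r0; rewrite -/h0 -/mass in massh.
have mass0 : 0 < mass by apply: lt_le_trans massh; rewrite mulr_gt0// exprn_gt0.
pose G := mollify K u r.
have cG : continuous G := mollify_continuous oU cu cK KU r0.
have Gu x (Kx : Ks x) : `|G x - mass * u x| <= w * mass.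
  exact: (mollify_osc oU cu cK KU r0 (BK x Kx) (fun z => osc x z Kx)).
pose F x := G x - mass * theta1 x.
have cF x : U x -> {for x, continuous F}.
  by move=> Ux; exact: cvgB (cG x) (cvgM (cvg_cst mass) (Ck1_continuous t1C Ux)).
have [x0 /set_mem Kx0 x0max] : exists2 x, x \in Ks & forall t, t \in Ks -> F t <= F x.
  apply: compact_EVT_max => //; first by exists y.
  by apply: continuous_in_subspaceT => x /set_mem Kx; apply: cF; exact/KU/KsK.
have Ux0 : U x0 by exact/KU/KsK.
(* On the sphere some coordinate differs from that of y by s, so the penalty is at least s^2. *)
have x0s : `|y - x0| < s.
  rewrite ltNge; apply/negP => sx.
  have qs : s ^+ 2 <= q x0.
    have [j jx] : exists j, s <= `|l j x0|.
      apply: contrapT => /forallNP H; move: sx; rewrite leNgt => /negP; apply.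
      apply: norm_rV_lt => // j; have := H j => /negP; rewrite -ltNge.
      by rewrite /l !mxE distrC.
    apply: (@le_trans _ _ (l j x0 * l j x0)).
      by rewrite -expr2 -[leRHS]real_normK ?num_real// lerXn2r ?nnegrE// ltW.
    by rewrite /q (bigD1 j)//= lerDl; apply: sumr_ge0 => k _; rewrite -expr2 sqr_ge0.
  have H1 := x0max y (mem_set yKs).
  have := Gu y yKs; rewrite ler_norml => /andP[H2 _].
  have := Gu x0 Kx0; rewrite ler_norml => /andP[_ H3].
  have [_ [_ H4]] := Hs2 x0 (KsK x0 Kx0).
  have H5 : F y = G y - mass * theta y by rewrite /F /theta1 qy addr0.
  rewrite H5 in H1.
  exact: (penalty_contradiction mass0 (exprn_gt0 2 s0) w2 qs H1 H2 H3 H4).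
have Ti i : \int[mu]_(z in U) (u z * 'D_(X i x0) (mollifier r) (z - x0)) =
    - (mass * vderiv (X i) theta1 x0).
  set v := X i x0.
  have -> : \int[mu]_(z in U) (u z * 'D_v (mollifier r) (z - x0)) =
      \int[mu]_(z in K) (u z * 'D_v (mollifier r) (z - x0)).
    have D0 z : ~ closed_ball_ normr x0 r z -> u z * 'D_v (mollifier r) (z - x0) = 0.
      move=> nz; rewrite -derive_translate.
      rewrite (@derive_support _ _ (closed_ball_ normr x0 r)) ?mulr0//.
        exact: closed_closed_ball_.
      by move=> t; exact: mollifier_supp.
    by rewrite (Rintegral_support (BK x0 Kx0) D0) (Rintegral_support (subset_trans (BK x0 Kx0) KU) D0).
  have dG (t : R) := derive_mollify oU cu cK KU r0 x0 v t.
  have [dt1 _] := t1C.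
  have dT (t : R) : U (x0 + t *: v) -> is_derive t (1:R)
      (fun t => mass * theta1 (x0 + t *: v)) (mass * 'D_v theta1 (x0 + t *: v)).
    move=> Ut; have H := @line_derive _ _ theta1 x0 v t (diff_derivable (dt1 _ Ut)).
    exact: (is_deriveZ mass H).
  have dF (t : R) (Ut : U (x0 + t *: v)) := is_deriveB (dG t) (dT t Ut).
  pose del := (s - `|y - x0|) / (`|v| + 1).
  have del0 : 0 < del by rewrite divr_gt0 ?subr_gt0// ltr_wpDl.
  have inKs (t : R) : `|t| < del -> Ks (x0 + t *: v).
    move=> td; rewrite /Ks /closed_ball_/= opprD addrA.
    apply: (le_trans (ler_normB _ _)); rewrite -lerBrDl normrZ.
    apply: (@le_trans _ _ (`|t| * (`|v| + 1))); first by rewrite ler_wpM2l// lerDl.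
    by rewrite -ler_pdivlMr ?ltr_wpDl// ltW.
  have inU t : `|t| < del -> U (x0 + t *: v) by move=> td; exact/KU/KsK/inKs.
  have U0 : U (x0 + 0 *: v) by rewrite scale0r addr0.
  have Fd (t : R) : `|t| < del -> derivable
      ((fun s => mollify K u r (x0 + s *: v)) - (fun t => mass * theta1 (x0 + t *: v))) t 1.
    by move=> /inU Ut; have [] := dF t Ut.
  have Fm (t : R) : `|t| < del -> F (x0 + t *: v) <= F (x0 + 0 *: v).
    by rewrite scale0r addr0 => /inKs/mem_set/x0max.
  have := eq0_derive_max del0 Fd (dF 0 U0) Fm.
  by rewrite scale0r addr0 => /eqP; rewrite subr_eq0 => /eqP <-; rewrite opprK.
have Wi i := commutator_estimate oU (fun j => Ck1_row_coord j oU (XC i)) cu (ug i)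
  r0 L0 (ltW w0) (Cb r r0) (subset_trans (BK x0 Kx0) KU)
  (fun z Bz j => le_trans (L1b i j j z (BK x0 Kx0 z Bz)) L1L).
have XL i z : closed_ball_ normr x0 r z -> forall j, `|X i z ord0 j - X i x0 ord0 j| <= L * r.
  move=> Bz j; have xz : z = x0 + (z - x0) by rewrite addrC subrK.
  have zr : `|z - x0| <= r by rewrite distrC.
  have segK (t : R) : 0 <= t <= 1 -> K (x0 + t *: (z - x0)).
    move=> /andP[t0 t1]; apply: (BK x0 Kx0); rewrite /closed_ball_/= opprD addrA subrr sub0r.
    by rewrite normrN normrZ ger0_norm// (le_trans _ zr)// ler_piMl.
  have [dX _] := Ck1_row_coord j oU (XC i).
  rewrite [in X in `|X - _|]xz.
  apply: (@segment_mean_value _ _ (fun z => X i z ord0 j)) => t /segK Kt.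
    exact: dX _ (KU _ Kt).
  rewrite (derive_linear (dX _ (KU _ Kt))); apply: (le_trans (ler_norm_sum _ _ _)).
  apply: (@le_trans _ _ (\sum_(k < n) r * L1)).
    apply: ler_sum => k _; rewrite normrM ler_pM//; last exact: L1b.
    by apply: le_trans (coord_norm_le _ _) zr.
  rewrite sumr_const card_ord -mulr_natl /L mulrA mulrAC ler_wpM2r ?(ltW r0)//.
  by rewrite ler_wpM2r// ler_nat.
have {}Wi i : `|\int[mu]_(z in U) (g z ord0 i * mollifier r (z - x0)) -
    mass * vderiv (X i) theta1 x0| <= w * C' * mass.
  have := Wi i (XL i) (fun z Bz => osc x0 z Kx0 Bz); rewrite Ti => H; apply: (le_trans H).
  have -> : w * (n%:R * (L * (1 + C))) * (2 * r) ^+ n = w * (C' * (h0 * r ^+ n)).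
    rewrite exprMn /C'; move: (2 ^+ n) (r ^+ n) (n%:R : R) => p1 p2 p3; field.
    by rewrite gt_eqF.
  by rewrite -mulrA; apply: (ler_wpM2l (ltW w0)); exact: ler_wpM2l C'0 _ _ massh.
have tphi : test_function U (fun z => mollifier r (z - x0)).
  exact: (test_function_mollifier r0 (subset_trans (BK x0 Kx0) KU)).
have ig i : mu.-integrable U (EFin \o (fun z => g z ord0 i * mollifier r (z - x0))).
  by have [_ igi _] := ug i; exact: test_mul_integrable oU igi tphi.
have iphi (a : R) : mu.-integrable U (EFin \o (fun z => a * mollifier r (z - x0))).
  have lc : loc_integrable U (fun=> a).
    by apply: (loc_integrable_continuous oU) => z _; exact: cst_continuous.
  exact: test_mul_integrable oU lc tphi.
have icg i : mu.-integrable U (EFin \o (fun z => c i * (g z ord0 i * mollifier r (z - x0)))).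
  exact: (integrableZl mU (c i) (ig i)).
have [isum sumE] := Rintegral_sum (index_enum 'I_m) mU icg.
(* Pointwise, c_i g_i <= (c_i^2 + g_i^2) / 2; sum and integrate against the mollifier. *)
have upper : \sum_(i < m) c i * \int[mu]_(z in U) (g z ord0 i * mollifier r (z - x0)) <=
    (N + M) / 2 * mass.
  have massE : \int[mu]_(z in U) ((N + M) / 2 * mollifier r (z - x0)) = (N + M) / 2 * mass.
    have i1 := iphi 1; rewrite (_ : (fun z => 1 * _) = (fun z => mollifier r (z - x0))) in i1; last first.
      by apply/funext => z; rewrite mul1r.
    rewrite (RintegralZl _ mU i1); congr (_ * _); rewrite /mass -(mollifier_massE x0 r0).
    have B0 z : ~ closed_ball_ normr x0 r z -> mollifier r (z - x0) = 0.
      exact: mollifier_supp.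
    exact: (Rintegral_support (subset_trans (BK x0 Kx0) KU) B0).
  have -> : \sum_(i < m) c i * \int[mu]_(z in U) (g z ord0 i * mollifier r (z - x0)) =
    \int[mu]_(z in U) (\sum_(i < m) c i * (g z ord0 i * mollifier r (z - x0))).
    by rewrite sumE; apply: eq_bigr => i _; rewrite (RintegralZl (c i) mU (ig i)).
  rewrite -massE -subr_ge0 -(RintegralB mU (iphi _) isum).
  apply: (ae_Rintegral_ge0 mU (integrableB mU (iphi _) isum)).
  apply: filterS gM => z gz Uz.
  have -> : \sum_(i < m) c i * (g z ord0 i * mollifier r (z - x0)) =
      (\sum_(i < m) c i * g z ord0 i) * mollifier r (z - x0).
    by rewrite mulr_suml; apply: eq_bigr => i _; rewrite mulrA.
  rewrite -mulrBl mulr_ge0 ?mollifier_ge0// subr_ge0.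
  apply: (@le_trans _ _ (\sum_(i < m) (c i ^+ 2 + g z ord0 i ^+ 2) / 2)).
    by apply: ler_sum => i _; exact: mulr_le_half_sqr.
  by rewrite -mulr_suml big_split/= ler_wpM2r// lerD2l gz.
(* Each average differs from mass c_i by at most mass (eta + w C'): eta from moving y to x0, w C'
   from the commutator. *)
have lower : \sum_(i < m) c i * \int[mu]_(z in U) (g z ord0 i * mollifier r (z - x0)) >=
    mass * (N - (S - 1) * (eta + w * C')).
  have -> : S - 1 = \sum_(i < m) `|c i| by rewrite /S addrK.
  rewrite /N mulrBr mulr_sumr mulr_suml mulr_sumr -sumrB; apply: ler_sum => i _.
  have := Wi i; set A := Rintegral _ _ _ => HA.
  have := Hs2 x0 (KsK x0 Kx0) => -[_ [/(_ i) Hc _]].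
  set V := vderiv _ _ _ in HA Hc.
  have HB : `|A - mass * c i| <= mass * (eta + w * C').
    have -> : A - mass * c i = (A - mass * V) + mass * (V - c i) by ring.
    apply: (le_trans (ler_normD _ _)); rewrite [leRHS]mulrDr [leRHS]addrC lerD//.
      by rewrite [leRHS]mulrC.
    by rewrite normrM (gtr0_norm mass0) ler_pM2l.
  have : `|c i * (A - mass * c i)| <= `|c i| * (mass * (eta + w * C')).
    by rewrite normrM ler_wpM2l.
  rewrite ler_norml => /andP[H _]; rewrite -/(c i).
  exact: error_lower_bound H.
(* The gap N - (N + M) / 2 = kap / 2 would be at most kap / 8 + kap / 8. *)
have := le_trans lower upper; rewrite mulrC ler_pM2r// => H.
have H1 : (S - 1) * (eta + w * C') <= S * (eta + w * C').
  by rewrite ler_wpM2r ?gerBl// addr_ge0 ?(ltW eta0)// mulr_ge0// ltW.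
have H2 : S * eta = kap / 8 by rewrite /eta; field; rewrite gt_eqF.
have H3 : S * (w * C') <= kap / 8.
  apply: (@le_trans _ _ (S * (w * (C' + 1)))).
    by rewrite ler_pM2l// ler_pM2l// lerDl.
  have C1 : 0 < C' + 1 by rewrite ltr_wpDl.
  rewrite -ler_pdivlMl// -ler_pdivlMr//; apply: (le_trans w1).
  rewrite le_eqVlt; apply/orP; left; apply/eqP; field.
  by rewrite !gt_eqF.
move: H H1 H2 H3 kap0; rewrite /kap mulrDr => *; lra.
Qed.


End viscosity_eikonal.

(** * The touching argument *)

Section derivation_rules.
Context {R : realType} {n : nat}.
Implicit Types (x v : 'rV[R]_n) (U : set 'rV[R]_n) (f g : 'rV[R]_n -> R).

Lemma is_derive_add f g x v (df dg : R) : is_derive x v f df -> is_derive x v g dg ->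
  is_derive x v (fun z => f z + g z) (df + dg).
Proof. by move=> Hf Hg; exact: is_deriveD Hf Hg. Qed.

Lemma is_derive_mul f g x v (df dg : R) : is_derive x v f df -> is_derive x v g dg ->
  is_derive x v (fun z => f z * g z) (f x * dg + g x * df).
Proof. by move=> Hf Hg; exact: is_deriveM Hf Hg. Qed.

Lemma is_derive_bigsum (I : Type) (s : seq I) (F : I -> 'rV[R]_n -> R) x v (dF : I -> R) :
  (forall i, is_derive x v (F i) (dF i)) ->
  is_derive x v (fun z => \sum_(i <- s) F i z) (\sum_(i <- s) dF i).
Proof.
move=> HF; elim: s => [|i s IH].
  rewrite (_ : (fun _ => _) = cst 0); last by apply/funext => z; rewrite big_nil.
  by rewrite big_nil; exact: is_derive_cst.
rewrite (_ : (fun _ => _) = fun z => F i z + \sum_(j <- s) F j z); last first.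
  by apply/funext => z; rewrite big_cons.
by rewrite big_cons; exact: is_derive_add.
Qed.

Lemma is_derive_cstf (c : R) x v : is_derive x v (fun=> c) 0.
Proof. exact: is_derive_cst. Qed.

Lemma Ck1_is_derive U f x v : Ck 1 U f -> U x -> is_derive x v f ('D_v f x).
Proof. by move=> [df _] Ux; apply: DeriveDef => //; exact: diff_derivable (df x Ux). Qed.

(** Mean value inequality on a ball where continuity keeps all partial derivatives small. *)
Lemma C1_zero_gradient_little_o U f x (t : R) : open U -> Ck 1 U f -> U x ->
  (forall v, 'D_v f x = 0) -> 0 < t ->
  \forall y \near x, `|f y - f x| <= t * `|y - x|.
Proof.
move=> oU [df cf] Ux d0 t0.
pose e j : 'rV[R]_n := delta_mx ord0 j.
(* The n partial derivatives add up; n + 1 also covers n = 0. *)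
pose t1 := t / n.+1%:R; have t10 : 0 < t1 by rewrite divr_gt0// ltr0n.
have H : \forall y \near x, U y /\ forall j, `|'D_(e j) f y| <= t1.
  apply: filterI; first exact: open_nbhs_nbhs.
  suff H j : \forall y \near x, `|'D_(e j) f y| <= t1.
    exact: (@filter_forall _ _ _ (nbhs x) _ H).
  have cj : {for x, continuous ('D_(e j) f)} := cf (e j) x Ux.
  have /cvgrPdist_le/(_ t1 t10) := cj.
  by apply: filterS => y; rewrite d0 sub0r normrN.
have /nbhs_ballP[r /= r0 Hr] := H.
apply/nbhs_ballP; exists r => //= y xy.
have seg (s : R) : 0 <= s <= 1 -> U (x + s *: (y - x)) /\ forall j, `|'D_(e j) f (x + s *: (y - x))| <= t1.
  move=> /andP[s0 s1]; apply: Hr; move: xy; rewrite -!ball_normE /= => xy.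
  rewrite opprD addrA subrr sub0r normrN normrZ ger0_norm//.
  by apply: le_lt_trans xy; rewrite (distrC x y) ler_piMl.
have -> : f y = f (x + (y - x)) by rewrite addrC subrK.
apply: segment_mean_value => s /seg[Us bs]; first exact: df.
rewrite (derive_linear (df _ Us)); apply: (le_trans (ler_norm_sum _ _ _)).
apply: (@le_trans _ _ (\sum_(j < n) `|y - x| * t1)).
  by apply: ler_sum => j _; rewrite normrM ler_pM// coord_norm_le.
rewrite sumr_const card_ord -mulr_natl mulrCA mulrC ler_wpM2r//.
by rewrite /t1 mulrA ler_pdivrMr ?ltr0n// mulrC ler_wpM2l ?ler_nat// ltW.
Qed.

End derivation_rules.

(** * The corrected test function and the contradiction for subsolutions *)

Section subsolution.
Context {R : realType} {n m : nat}.
Implicit Types (x y v : 'rV[R]_n) (U : set 'rV[R]_n).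
Variables (Omega : set 'rV[R]_n) (X : 'I_m -> 'rV[R]_n -> 'rV[R]_n).
(** [Dphi] need only agree with the partial derivatives on Omega, so the section also applies to -
    phi with the negated partial derivatives of phi. *)
Variables (phi : 'rV[R]_n -> R) (Dphi : 'I_n -> 'rV[R]_n -> R) (x0 : 'rV[R]_n).
Hypotheses (oO : open Omega) (XC : forall i, Ck 2 Omega (X i)).
Hypotheses (phiC1 : Ck 1 Omega phi) (DphiC : forall k, Ck 1 Omega (Dphi k)).
Hypothesis DphiE : forall k x, Omega x -> 'D_(delta_mx ord0 k) phi x = Dphi k x.
Hypothesis Ox0 : Omega x0.
Hypothesis A_gt0 : 0 < inf_laplace_op X phi x0.

Let e k : 'rV[R]_n := delta_mx ord0 k.
Let XC1 i : Ck 1 Omega (X i) := Ck1W (XC i).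
Let XkC i k : Ck 1 Omega (fun x => X i x ord0 k) := Ck1_row_coord k oO (XC1 i).

Let P i x : R := \sum_(k < n) X i x ord0 k * Dphi k x.

Let PC i : Ck 1 Omega (P i).
Proof. exact: (Ck1_sum (index_enum 'I_n) oO (fun k => Ck1M oO (XkC i k) (DphiC k))). Qed.

Let PE i x : Omega x -> vderiv (X i) phi x = P i x.
Proof.
move=> Ox; rewrite (vderivE _ phiC1 Ox).
by apply: eq_bigr => k _; rewrite DphiE.
Qed.

Let kap := inf_laplace_op X phi x0.
(** Partial derivatives at x0 of half of |X phi|^2, the coefficients of the form [beta]. *)
Let b k : R := \sum_(j < m) P j x0 * 'D_(e k) (P j) x0.
Let beta v : R := \sum_(k < n) v ord0 k * b k.
Let a k : R := \sum_(i < m) P i x0 * X i x0 ord0 k.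

Let betaE v : beta v = \sum_(j < m) P j x0 * 'D_v (P j) x0.
Proof.
rewrite /beta /b; under eq_bigr do rewrite mulr_sumr.
rewrite exchange_big/=; apply: eq_bigr => j _.
have [dP _] := PC j; rewrite (derive_linear (dP x0 Ox0)) mulr_sumr.
by apply: eq_bigr => k _; rewrite mulrCA.
Qed.

Let beta_a : \sum_(i < m) P i x0 * beta (X i x0) = - kap.
Proof.
rewrite /kap inf_laplace_opE opprK; apply: eq_bigr => i _.
rewrite betaE mulr_sumr; apply: eq_bigr => j _.
rewrite !PE// -mulrA; congr (_ * (_ * _)); apply/esym.
by apply: (eq_on_derive _ oO) => // y Oy; exact: PE.
Qed.

Let yk k x : R := x ord0 k + (- x0 ord0 k).
Let l0 x : R := \sum_(k < n) yk k x * b k.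
(** Let T v = v + beta(v) a / kap. As beta(a) = - kap, T is the projection onto ker beta along a,
    and [Lam] lists the coordinates of T(x - x0). In the Hessian of [q] below, T kills a, and the
    term from [l0] sends a to beta(a) beta / kap = - beta. Both terms vanish together only at x0,
    hence definiteness. *)
Let Lam l x : R := yk l x + l0 x * (a l / kap).
Let q x : R := 2^-1 * (kap^-1 * (l0 x * l0 x) + \sum_(l < n) Lam l x * Lam l x).

Let ykC U k : open U -> Ck 1 U (yk k).
Proof. by move=> oU; exact: (Ck1D oU (Ck1_coordinate U k) (Ck1_cst U (- x0 ord0 k))). Qed.
Let l0C U : open U -> Ck 1 U l0.
Proof.
move=> oU; exact: (Ck1_sum (index_enum 'I_n) oU (fun k => Ck1M oU (ykC k oU) (Ck1_cst U (b k)))).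
Qed.
Let LamC U l : open U -> Ck 1 U (Lam l).
Proof.
by move=> oU; exact: (Ck1D oU (ykC l oU) (Ck1M oU (l0C oU) (Ck1_cst U (a l / kap)))).
Qed.
Let qC U : open U -> Ck 1 U q.
Proof.
move=> oU; apply: (Ck1M oU (Ck1_cst U 2^-1)).
apply: (Ck1D oU (Ck1M oU (Ck1_cst U kap^-1) (Ck1M oU (l0C oU) (l0C oU)))).
exact: (Ck1_sum (index_enum 'I_n) oU (fun k => Ck1M oU (LamC k oU) (LamC k oU))).
Qed.

Let dyk k x v : is_derive x v (yk k) (v ord0 k).
Proof.
by apply: is_derive_eq (is_derive_add (is_derive_coord x v k) (is_derive_cstf _ x v)) _; rewrite addr0.
Qed.
Let dl0 x v : is_derive x v l0 (beta v).
Proof.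
apply: is_derive_eq (is_derive_bigsum (index_enum 'I_n)
  (fun k => is_derive_mul (dyk k x v) (is_derive_cstf (b k) x v))) _.
by apply: eq_bigr => k _; rewrite mulr0 add0r mulrC.
Qed.
Let dLam l x v : is_derive x v (Lam l) (v ord0 l + beta v * (a l / kap)).
Proof.
apply: is_derive_eq (is_derive_add (dyk l x v)
  (is_derive_mul (dl0 x v) (is_derive_cstf (a l / kap) x v))) _.
by rewrite mulr0 add0r [_ * beta v]mulrC.
Qed.
Let dq x v : is_derive x v q (l0 x * (beta v / kap) +
  \sum_(l < n) Lam l x * (v ord0 l + beta v * (a l / kap))).
Proof.
have H := is_derive_bigsum (index_enum 'I_n)
  (fun l => is_derive_mul (dLam l x v) (dLam l x v)).
have H1 := is_derive_mul (is_derive_cstf kap^-1 x v) (is_derive_mul (dl0 x v) (dl0 x v)).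
apply: is_derive_eq (is_derive_mul (is_derive_cstf 2^-1 x v) (is_derive_add H1 H)) _.
rewrite !mulr0 addr0 addr0 mulrDr; congr (_ + _).
  by field; rewrite gt_eqF.
rewrite mulr_sumr; apply: eq_bigr => l _; rewrite -mulr2n -[X in _ * X]mulr_natl.
by rewrite mulrA mulVf ?mul1r// pnatr_eq0.
Qed.

Let yk0 k : yk k x0 = 0. Proof. by rewrite /yk subrr. Qed.
Let l00 : l0 x0 = 0. Proof. by apply: big1 => k _; rewrite yk0 mul0r. Qed.
Let Lam0 l : Lam l x0 = 0. Proof. by rewrite /Lam yk0 l00 mul0r addr0. Qed.
Let q0 : q x0 = 0.
Proof. by rewrite /q l00 !mul0r mulr0 add0r big1 ?mulr0// => l _; rewrite Lam0 mulr0. Qed.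

Let psi x := phi x + q x.
Let psiC : Ck 1 Omega psi := Ck1D oO phiC1 (qC oO).

Let BX i x : R := \sum_(k < n) X i x ord0 k * b k.
Let BXC i : Ck 1 Omega (BX i).
Proof. exact: (Ck1_sum (index_enum 'I_n) oO (fun k => Ck1M oO (XkC i k) (Ck1_cst Omega (b k)))). Qed.
(** Coordinate l of T(X_i(x)), with T the projection behind [Lam]. *)
Let E i l x : R := X i x ord0 l + BX i x * (a l / kap).
Let EC i l : Ck 1 Omega (E i l).
Proof. exact: (Ck1D oO (XkC i l) (Ck1M oO (BXC i) (Ck1_cst Omega (a l / kap)))). Qed.

(** Explicit C^1 form of X_i psi, so that N = |X psi|^2 can be differentiated once. *)
Let Q i x : R := P i x + (l0 x * (BX i x * kap^-1) + \sum_(l < n) Lam l x * E i l x).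
Let QC i : Ck 1 Omega (Q i).
Proof.
apply: (Ck1D oO (PC i)); apply: (Ck1D oO).
  exact: (Ck1M oO (l0C oO) (Ck1M oO (BXC i) (Ck1_cst Omega kap^-1))).
exact: (Ck1_sum (index_enum 'I_n) oO (fun l => Ck1M oO (LamC l oO) (EC i l))).
Qed.

Let QE i x : Omega x -> vderiv (X i) psi x = Q i x.
Proof.
move=> Ox; rewrite /vderiv.
have [_ ->] := is_derive_add (Ck1_is_derive (X i x) phiC1 Ox) (dq x (X i x)).
by congr (_ + _); rewrite -PE.
Qed.

Let Q0 i : Q i x0 = P i x0.
Proof. by rewrite /Q l00 mul0r add0r big1 ?addr0// => l _; rewrite Lam0 mul0r. Qed.

Let N x : R := \sum_(i < m) Q i x * Q i x.
Let NC : Ck 1 Omega N.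
Proof. exact: (Ck1_sum (index_enum 'I_m) oO (fun i => Ck1M oO (QC i) (QC i))). Qed.

(* the Hessian of q maps a to - b, which cancels the gradient of |X phi|^2 / 2 *)
Let dN0 v : 'D_v N x0 = 0.
Proof.
have dQ i : is_derive x0 v (Q i) ('D_v (P i) x0 + (beta v * (BX i x0 / kap) +
    \sum_(l < n) (v ord0 l + beta v * (a l / kap)) * E i l x0)).
  have BKC := Ck1M oO (BXC i) (Ck1_cst Omega kap^-1).
  have H := is_derive_bigsum (index_enum 'I_n)
    (fun l => is_derive_mul (dLam l x0 v) (Ck1_is_derive v (EC i l) Ox0)).
  apply: is_derive_eq (is_derive_add (Ck1_is_derive v (PC i) Ox0)
    (is_derive_add (is_derive_mul (dl0 x0 v) (Ck1_is_derive v BKC Ox0)) H)) _.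
  congr (_ + (_ + _)); first by rewrite l00 mul0r add0r mulrC.
  by apply: eq_bigr => l _; rewrite Lam0 mul0r add0r mulrC.
have [_ ->] := is_derive_bigsum (index_enum 'I_m) (fun i => is_derive_mul (dQ i) (dQ i)).
have kn0 : kap != 0 by rewrite gt_eqF.
(* This is T a = 0, read coordinatewise. *)
have sE l : \sum_(i < m) P i x0 * E i l x0 = 0.
  rewrite /E; under eq_bigr do rewrite mulrDr mulrA.
  by rewrite big_split/= -mulr_suml -/(a l) beta_a; field.
transitivity (2 * \sum_(i < m) (P i x0 * 'D_v (P i) x0 + (beta v / kap * (P i x0 * BX i x0) +
    \sum_(l < n) (v ord0 l + beta v * (a l / kap)) * (P i x0 * E i l x0)))).
  rewrite mulr_sumr; apply: eq_bigr => i _; rewrite Q0.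
  have -> : \sum_(l < n) (v ord0 l + beta v * (a l / kap)) * (P i x0 * E i l x0) =
    P i x0 * \sum_(l < n) (v ord0 l + beta v * (a l / kap)) * E i l x0.
    by rewrite mulr_sumr; apply: eq_bigr => l _; rewrite mulrCA.
  by field.
rewrite 2!big_split/= -betaE -mulr_sumr beta_a exchange_big/= [X in _ + (_ + X)]big1.
  by field.
by move=> l _; rewrite -mulr_sumr sE mulr0.
Qed.

(** Coercivity constant of [q]: coordinate l of x - x0 is Lam_l - l0 a_l / kap, with Lam_l^2 <= 2 q
    and l0^2 <= 2 kap q, so its square is at most 4 q (1 + a_l^2 / kap). *)
Let c : R := (4 * (1 + \sum_(l < n) a l ^+ 2 / kap))^-1.
Let c_gt0 : 0 < c.
Proof.
rewrite invr_gt0 mulr_gt0// ltr_wpDr// sumr_ge0// => l _.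
by rewrite divr_ge0 ?sqr_ge0// ltW.
Qed.

Let q_ge x : c * `|x - x0| ^+ 2 <= q x.
Proof.
have qn0 : 0 <= \sum_(l < n) Lam l x * Lam l x.
  by apply: sumr_ge0 => l _; rewrite -expr2 sqr_ge0.
have q_ge0 : 0 <= q x.
  rewrite /q; apply: mulr_ge0 => //; apply: addr_ge0 => //.
  by apply: mulr_ge0; [rewrite invr_ge0 ltW|rewrite -expr2 sqr_ge0].
have l02 : l0 x ^+ 2 <= 2 * kap * q x.
  rewrite /q; set s := \sum_(l < n) _.
  have -> : 2 * kap * (2^-1 * (kap^-1 * (l0 x * l0 x) + s)) = l0 x ^+ 2 + kap * s.
    by field; rewrite gt_eqF.
  by rewrite lerDl mulr_ge0// ltW.
have Lam2 l : Lam l x ^+ 2 <= 2 * q x.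
  rewrite /q mulrA divff ?pnatr_eq0// mul1r (bigD1 l)//= -expr2 addrCA lerDl addr_ge0//.
    by rewrite mulr_ge0 ?invr_ge0 ?(ltW A_gt0)// ?sqr_ge0.
  by apply: sumr_ge0 => k _; rewrite -expr2 sqr_ge0.
have yl l : yk l x ^+ 2 <= q x / c.
  have -> : yk l x = Lam l x - l0 x * (a l / kap) by rewrite /Lam addrK.
  have H : (l0 x * (a l / kap)) ^+ 2 <= 2 * q x * (a l ^+ 2 / kap).
    have -> : 2 * q x * (a l ^+ 2 / kap) = 2 * kap * q x * (a l / kap) ^+ 2.
      by field; rewrite gt_eqF.
    by rewrite exprMn ler_wpM2r// sqr_ge0.
  have H2 : a l ^+ 2 / kap <= \sum_(l < n) a l ^+ 2 / kap.
    rewrite (bigD1 l)//= lerDl; apply: sumr_ge0 => k _.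
    by rewrite divr_ge0 ?sqr_ge0// ltW.
  have := Lam2 l; rewrite /c invrK; move: H H2 (q_ge0).
  move: (l0 x * _) (a l ^+ 2 / kap) (\sum_(l < n) _) (Lam l x) (q x) => A1 A2 A3 A4 A5.
  move=> H H2 q0' H3.
  have H4 : A5 * A2 <= A5 * A3 by rewrite ler_wpM2l.
  by have := sqr_ge0 (A4 + A1); lra.
rewrite -ler_pdivlMl// mulrC.
have qc0 : 0 <= q x / c by rewrite divr_ge0// ltW.
rewrite -[leRHS]sqr_sqrtr//; rewrite lerXn2r ?nnegrE ?sqrtr_ge0//.
apply: norm_rV_le; first exact: sqrtr_ge0.
by move=> j; rewrite -sqrtr_sqr ler_sqrt// !mxE; exact: yl.
Qed.



(** Half the rate at which the tilt raises the squared gradient: |X theta_d|^2 = N + 2 d W + d^2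
    |BX|^2. *)
Let W x : R := \sum_(i < m) Q i x * (- BX i x).
Let Wx0 : W x0 = kap.
Proof.
rewrite -[RHS]opprK -beta_a -sumrN; apply: eq_bigr => i _.
by rewrite Q0 mulrN.
Qed.
Let W_near : \forall x \near x0, kap / 2 <= W x.
Proof.
have cW : {for x0, continuous W}.
  apply: continuous_at_sum => i.
  exact: cvgM (Ck1_continuous (QC i) Ox0) (cvgN (Ck1_continuous (BXC i) Ox0)).
have /cvgrPdist_le/(_ (kap / 2)) := cW; rewrite divr_gt0// => /(_ isT).
by apply: filterS => x; rewrite Wx0 ler_norml => /andP[_ H]; lra.
Qed.

Let C1 : R := \sum_(k < n) `|b k|.
Let C1_ge0 : 0 <= C1. Proof. by apply: sumr_ge0. Qed.
Let l0_le x : `|l0 x| <= C1 * `|x - x0|.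
Proof.
apply: (le_trans (ler_norm_sum _ _ _)); rewrite /C1 mulr_suml; apply: ler_sum => k _.
rewrite normrM mulrC ler_wpM2l//.
by have := coord_norm_le (x - x0) k; rewrite !mxE.
Qed.

Let theta (d : R) x : R := psi x + (- d) * l0 x.
Let thetaC d : Ck 1 Omega (theta d).
Proof. exact: (Ck1D oO psiC (Ck1M oO (Ck1_cst Omega (- d)) (l0C oO))). Qed.
Let thetaE d i x : Omega x -> vderiv (X i) (theta d) x = Q i x + d * (- BX i x).
Proof.
move=> Ox; rewrite /vderiv.
have [_ ->] := is_derive_add (Ck1_is_derive (X i x) psiC Ox)
  (is_derive_mul (is_derive_cstf (- d) x (X i x)) (dl0 x (X i x))).
by rewrite [X in X + _](QE i Ox) mulr0 addr0 mulNr mulrN.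
Qed.

Lemma touching_contradiction (u : 'rV[R]_n -> R) :
  (forall x, Omega x -> {for x, continuous u}) -> C1_minimizer X Omega u ->
  (\forall x \near x0, u x - phi x <= u x0 - phi x0) -> False.
Proof.
move=> cu umin umax.
(* The tilt has size d = t2 r; on B it shifts values by at most d C1 r < c r^2, the depth of w below
   u at x0. *)
pose t2 := c / (2 * (C1 + 1)).
have C11 : 0 < C1 + 1 by rewrite ltr_wpDl.
have t20 : 0 < t2 by rewrite divr_gt0// mulr_gt0.
(* Over B the function N then varies by at most t1 r = d kap / 4, against a gain of at least d kap
   from the tilt. *)
pose t1 := t2 * kap / 4.
have t10 : 0 < t1 by rewrite divr_gt0// mulr_gt0.
have N_near := C1_zero_gradient_little_o oO NC Ox0 dN0 t10.
have O_near : \forall x \near x0, Omega x by exact: open_nbhs_nbhs.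
have [e0 e00 He] := closed_ball_near (filterI (filterI O_near umax) (filterI N_near W_near)).
pose r := e0 / 2; have r0 : 0 < r by rewrite divr_gt0.
have re0 : r < e0 by rewrite /r ltr_pdivrMr// ltr_pMr// ltr1n.
pose B := closed_ball_ normr x0 r.
have cB : compact B by exact: compact_closed_ball_rV.
have clB : closed B by exact: closed_closed_ball_.
have Bx0 : B x0 by rewrite /B /closed_ball_/= subrr normr0 ltW.
have Be x : B x -> closed_ball_ normr x0 e0 x by move=> Bx; exact: le_trans Bx (ltW re0).
have BO x : B x -> Omega x by move=> /Be/He[[]].
pose k0 := u x0 - phi x0 - c * r ^+ 2.
pose w x := psi x + k0.
have wC : Ck 1 Omega w := Ck1D oO psiC (Ck1_cst Omega k0).
(* The radius e0 only localises. Coercivity of [q] confines U to the smaller ball B, so the sphere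
   of radius e0 adds nothing to its boundary. *)
pose U := [set x | ball x0 e0 x /\ w x < u x].
have UB x : U x -> B x.
  move=> [x0x wx]; have xe : closed_ball_ normr x0 e0 x.
    by move: x0x; rewrite -ball_normE; exact: ltW.
  have [[Ox ux] _] := He x xe.
  have := q_ge x; move: wx; rewrite /w /psi /k0 => wx qx.
  have : c * `|x - x0| ^+ 2 <= c * r ^+ 2 by lra.
  rewrite ler_pM2l// ler_pXn2r ?nnegrE ?(ltW r0)//.
  by rewrite /B /closed_ball_/= distrC.
have UO : U `<=` Omega by move=> x /UB/BO.
have oU : open U.
  rewrite openE => x Ux; have [x0x wx] := Ux; have Ox := UO x Ux.
  have N1 : nbhs x (ball x0 e0) by apply: open_nbhs_nbhs; split; [exact: ball_open|].
  have cuw : {for x, continuous (fun x => u x - w x)}.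
    exact: cvgB (cu x Ox) (Ck1_continuous wC Ox).
  have uwx : 0 < u x - w x by rewrite subr_gt0.
  have N2 : nbhs x [set y | 0 < u y - w y] by apply: cvgr_gt cuw 0 uwx.
  have N3 : nbhs x U.
    by apply: filterS (filterI N1 N2) => y [By H]; split => //; move: H; rewrite /= subr_gt0.
  exact: N3.
have notU y : B y -> ~ U y -> u y <= w y.
  move=> By nUy; rewrite leNgt; apply/negP => wy; apply: nUy; split => //.
  by rewrite -ball_normE /=; apply: le_lt_trans By re0.
have wE i x : Omega x -> vderiv (X i) w x = Q i x.
  move=> Ox; rewrite /vderiv.
  have [_ ->] := is_derive_add (Ck1_is_derive (X i x) psiC Ox) (is_derive_cstf k0 x (X i x)).
  by rewrite addr0; exact: QE.
pose M := N x0 + t1 * r.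
have Nx00 : 0 <= N x0 by apply: sumr_ge0 => i _; rewrite -expr2 sqr_ge0.
have M0 : 0 <= M by rewrite addr_ge0// mulr_ge0// ltW.
have NB x : B x -> `|N x - N x0| <= t1 * r.
  move=> Bx; have [_ [Nx _]] := He x (Be x Bx); apply: (le_trans Nx).
  by rewrite ler_pM2l// distrC.
have wM x : U x -> \sum_(i < m) vderiv (X i) w x ^+ 2 <= M.
  move=> Ux; have -> : \sum_(i < m) vderiv (X i) w x ^+ 2 = N x.
    by apply: eq_bigr => i _; rewrite wE ?expr2//; exact: UO.
  by have := NB x (UB x Ux); rewrite ler_norml /M => /andP[_]; rewrite lerBlDl.
have [Cw _ wb] := continuous_compact_bounded cB (fun x Bx => Ck1_continuous wC (BO x Bx)).
(* Boundary points lie in B, where u and w are continuous, so it suffices that w = u there. *)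
have bd : eq_on_boundary U w u.
  move=> y [cUy nUy].
  have By : B y by apply: clB; apply: closureS cUy; exact: UB.
  have Oy := BO y By.
  have cwu : {for y, continuous (fun x => w x - u x)}.
    exact: cvgB (Ck1_continuous wC Oy) (cu y Oy).
  have nU : ~ U y by move=> Uy; apply: nUy; exact: open_nbhs_nbhs.
  have E0 : w y - u y = 0.
    apply/eqP; rewrite subr_eq0 eq_le (notU y By nU) andbT leNgt; apply/negP => uw.
    have wuy : 0 < w y - u y by rewrite subr_gt0.
    have H : nbhs y [set z | 0 < w z - u z] by apply: cvgr_gt cwu 0 wuy.
    have [z [[_ wz] ]] := cUy _ H; rewrite /= subr_gt0 => /lt_trans/(_ wz).
    by rewrite ltxx.
  by rewrite -E0; apply: cvg_within_filter; exact: cwu.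
have [g [ug gM]] := umin U w M Cw oU UO (Ck1_sub UO wC) (fun x Ux => wb x (UB x Ux)) bd M0 wM.
pose d := t2 * r.
have d0 : 0 < d by rewrite mulr_gt0.
pose F x := u x - theta d x.
have [y /set_mem By ymax] : exists2 y, y \in B & forall t, t \in B -> F t <= F y.
  apply: compact_EVT_max => //; first by exists x0.
  apply: continuous_in_subspaceT => x /set_mem Bx.
  exact: cvgB (cu x (BO x Bx)) (Ck1_continuous (thetaC d) (BO x Bx)).
have Oy := BO y By.
(* At a point of B outside U, u - psi is at least c r^2 below its value at x0, more than the tilt
   can compensate. *)
have Uy : U y.
  apply: contrapT => nU; have uy := notU y By nU.
  have := ymax x0 (mem_set Bx0); rewrite /F /theta /psi l00 q0.
  have ly : d * l0 y <= d * (C1 * r).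
    rewrite ler_pM2l//; apply: le_trans (ler_norm _) (le_trans (l0_le y) _).
    by rewrite ler_wpM2l// distrC.
  have cr : d * (C1 * r) < c * r ^+ 2.
    have -> : d * (C1 * r) = c * r ^+ 2 * (C1 / (2 * (C1 + 1))).
      by rewrite /d /t2; field; rewrite gt_eqF.
    rewrite gtr_pMr ?mulr_gt0 ?exprn_gt0// ltr_pdivrMr ?mulr_gt0// mul1r.
    by have := C1_ge0; lra.
  move: uy; rewrite /w /psi /k0 => uy H; lra.
have ylocal : \forall x \near y, u x - theta d x <= u y - theta d y.
  have : \forall x \near y, U x by exact: open_nbhs_nbhs.
  by apply: filterS => x /UB/mem_set/ymax.
(* The tilted function touches u from above at y, so its squared gradient there would be at most M;
   the rest shows that it exceeds M. *)
have := hgrad_bound_viscosity oU (fun x Ux => cu x (UO x Ux))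
  (fun i => Ck1_sub UO (XC1 i)) ug gM (Ck1_sub UO (thetaC d)) Uy ylocal.
apply/negP; rewrite -ltNge.
have -> : \sum_(i < m) vderiv (X i) (theta d) y ^+ 2 =
    N y + 2 * d * W y + d ^+ 2 * \sum_(i < m) BX i y ^+ 2.
  rewrite /N /W !mulr_sumr -!big_split/=; apply: eq_bigr => i _.
  by rewrite thetaE//; ring.
have S0 : 0 <= d ^+ 2 * \sum_(i < m) BX i y ^+ 2.
  by rewrite mulr_ge0 ?sqr_ge0// sumr_ge0// => i _; exact: sqr_ge0.
have [_ [_ Wy]] := He y (Be y By).
have := NB y By; rewrite ler_norml => /andP[Ny _].
have dW : d * kap <= 2 * d * W y.
  have -> : d * kap = 2 * d * (kap / 2) by field.
  by rewrite ler_pM2l// mulr_gt0.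
have dk : t1 * r = d * kap / 4 by rewrite /t1 /d; field.
have dk0 : 0 < d * kap by rewrite mulr_gt0.
rewrite /M; rewrite dk in Ny *; lra.
Qed.

End subsolution.

(** * Sub- and supersolutions, and the conclusion *)

Section viscosity.
Context {R : realType} {n m : nat}.
Implicit Types (Omega : set 'rV[R]_n) (X : 'I_m -> 'rV[R]_n -> 'rV[R]_n).

Lemma Ck1_partial Omega (phi : 'rV[R]_n -> R) k : Ck 2 Omega phi ->
  Ck 1 Omega ('D_(delta_mx ord0 k) phi).
Proof. by move=> [_ H]; exact: H. Qed.

Lemma C1_minimizer_subsolution Omega X u : open Omega -> (forall i, Ck 2 Omega (X i)) ->
  (forall x, Omega x -> {for x, continuous u}) -> C1_minimizer X Omega u ->
  viscosity_subsolution X Omega u.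
Proof.
move=> oO XC cu umin phi x0 phiC Ox0 umax; rewrite leNgt; apply/negP => A0.
exact: (touching_contradiction oO XC (Ck1W phiC) (fun k => Ck1_partial k phiC)
  (fun k x _ => erefl) Ox0 A0 cu umin umax).
Qed.

(** The operator is homogeneous of degree 3, hence odd. The form [-1 * phi] fits the product rule
    [Ck1M]. *)
Lemma inf_laplace_opN Omega X (phi : 'rV[R]_n -> R) x0 : open Omega ->
  (forall i, Ck 1 Omega (X i)) -> Ck 2 Omega phi -> Omega x0 ->
  inf_laplace_op X (fun x => -1 * phi x) x0 = - inf_laplace_op X phi x0.
Proof.
move=> oO XC phiC Ox0; have phiC1 := Ck1W phiC.
have DN (f : 'rV[R]_n -> R) v x : differentiable f x -> 'D_v (fun x => -1 * f x) x = - 'D_v f x.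
  move=> df; have H := is_derive_mul (is_derive_cstf (-1) x v)
    (DeriveDef (diff_derivable (v := v) df) erefl).
  by have [_ ->] := H; rewrite mulr0 addr0 mulN1r.
pose P i x : R := \sum_(k < n) X i x ord0 k * 'D_(delta_mx ord0 k) phi x.
have PC i : Ck 1 Omega (P i).
  exact: (Ck1_sum (index_enum 'I_n) oO
    (fun k => Ck1M oO (Ck1_row_coord k oO (XC i)) (Ck1_partial k phiC))).
have PE i x : Omega x -> vderiv (X i) phi x = P i x by exact: vderivE phiC1.
have NE i x : Omega x -> vderiv (X i) (fun x => -1 * phi x) x = -1 * P i x.
  move=> Ox; have [dphi _] := phiC1.
  by rewrite /vderiv (DN _ _ _ (dphi x Ox)) mulN1r -PE.
rewrite !inf_laplace_opE opprK -sumrN; apply: eq_bigr => i _.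
rewrite -sumrN; apply: eq_bigr => j _; rewrite !NE// !PE//.
have [dP _] := PC j.
rewrite [X in _ * X](eq_on_derive _ oO (fun y => NE j y) Ox0) (DN _ _ _ (dP x0 Ox0)).
rewrite [X in _ = _ * X](eq_on_derive _ oO (fun y => PE j y) Ox0).
ring.
Qed.

Lemma C1_minimizer_supersolution Omega X u : open Omega -> (forall i, Ck 2 Omega (X i)) ->
  (forall x, Omega x -> {for x, continuous u}) -> C1_minimizer X Omega u ->
  viscosity_supersolution X Omega u.
Proof.
move=> oO XC cu umin phi x0 phiC Ox0 uphi.
rewrite leNgt; apply/negP => A0.
have XC1 i : Ck 1 Omega (X i) := Ck1W (XC i).
have phiC1 := Ck1W phiC; have [dphi _] := phiC1.
have E k x : Omega x -> 'D_(delta_mx ord0 k) (fun x => -1 * phi x) x =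
    -1 * 'D_(delta_mx ord0 k) phi x.
  move=> Ox; have [_ ->] := is_derive_mul (is_derive_cstf (-1) x (delta_mx ord0 k))
    (Ck1_is_derive (delta_mx ord0 k) phiC1 Ox).
  by rewrite mulr0 addr0.
have A0' : 0 < inf_laplace_op X (fun x => -1 * phi x) x0.
  by rewrite (inf_laplace_opN oO)// oppr_gt0.
apply: (touching_contradiction oO XC (Ck1M oO (Ck1_cst Omega (-1)) phiC1)
  (fun k => Ck1M oO (Ck1_cst Omega (-1)) (Ck1_partial k phiC)) E Ox0 A0'
  (fun x Ox => cvgN (cu x Ox)) (C1_minimizerN umin)).
by apply: filterS uphi => x; rewrite !mulN1r -!opprD lerN2.
Qed.

End viscosity.

Theorem corollaryB (R : realType) (n m : nat) (Omega : set 'rV[R]_n)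
    (X : 'I_m -> 'rV[R]_n -> 'rV[R]_n) (u : 'rV[R]_n -> R) :
  bounded_domain Omega ->
  (forall i, Ck 2 Omega (X i)) ->
  hormander X Omega ->
  AMLE X Omega u ->
  viscosity_solution X Omega u.
Proof.
move=> [oO _ _ _] XC _ uA; have [[cu _ _] _] := uA.
have XC1 i : Ck 1 Omega (X i) := Ck1W (XC i).
have umin := AMLE_C1_minimizer XC1 uA.
split; [exact: cu|exact: C1_minimizer_subsolution|exact: C1_minimizer_supersolution].
Qed.
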